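(* Let $n\ge 2$ be an integer, $\sigma\ge 0$, and let $F=F_1+iF_2:\mathbb{C}\to\mathbb{C}$ be locally Lipschitz with $F(z)=\mathcal{O}(|z|^{n-1})$ as $|z|\to\infty$. Let $\phi$ be the local stochastic flow on $\mathbb{R}^2$ associated to the SDE which in complex notation $Z_t=X_t+iY_t$ reads $$\mathrm{d}Z_t=\left(Z_t^n+F(Z_t)\right)\mathrm{d}t+\sigma\,\mathrm{d}B_t,$$ where $B=W^{(1)}+iW^{(2)}$ is a complex Brownian motion, and write $\phi_t=\phi_{0,t}$ and $\phi_t^{(1)}$ for its first component. Then there exists $T\in(0,\infty)$ such that $$\lim_{x_0\to\infty}\mathbb{P}\left(\sup_{z\in\mathfrak{I}}\ \sup_{t\le T}\phi_t^{(1)}(z)=\infty\right)=1,$$ where $\mathfrak{I}=\mathfrak{I}(x_0)=\{x_0\}\times\left[-\tan\left(\tfrac{\pi}{2n}\right)x_0,\ \tan\left(\tfrac{\pi}{2n}\right)x_0\right]$ (the number $T$ does not depend on $x_0$).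
   Context: Complex Brownian motion means $B=W^{(1)}+iW^{(2)}$ with $W^{(1)},W^{(2)}$ independent standard real Brownian motions started at $0$ on a filtered probability space $(\Omega,\mathcal{F},(\mathcal{F}_t),\mathbb{P})$ satisfying the usual conditions. $\mathbb{C}$ is identified with $\mathbb{R}^2$ via $z=x+iy\leftrightarrow(x,y)$. In Cartesian coordinates the SDE is $\mathrm{d}X_t=(b_1(X_t,Y_t)+\hat F_1(X_t,Y_t))\,\mathrm{d}t+\sigma\,\mathrm{d}W^{(1)}_t$, $\mathrm{d}Y_t=(b_2(X_t,Y_t)+\hat F_2(X_t,Y_t))\,\mathrm{d}t+\sigma\,\mathrm{d}W^{(2)}_t$, where $b_1(x,y)=\mathrm{Re}\,(x+iy)^n$, $b_2(x,y)=\mathrm{Im}\,(x+iy)^n$ and $\hat F_j(x,y)=F_j(x+iy)$ for $j=1,2$. Local stochastic flow on $\mathbb{R}^d$: let $\mathfrak{e}(s,x)$, $s\ge0$, $x\in\mathbb{R}^d$, be a random field with values in $(s,\infty]$ which is lower semicontinuous in $s$ and $x$, and set $\mathbb{D}_{s,t}(\omega)=\{x\in\mathbb{R}^d:\mathfrak{e}(s,x,\omega)>t\}$. Let $\phi_{s,t}(x,\omega)$, $x\in\mathbb{R}^d$, $0\le s\le t<\mathfrak{e}(s,x)$, be a continuous $\mathbb{R}^d$-valued random field defined on the random domain of those $(s,t,x)$ with $x\in\mathbb{D}_{s,t}(\omega)$, and let $\mathbb{R}_{s,t}(\omega)$ be the range of $\phi_{s,t}(\cdot,\omega)$ on $\mathbb{D}_{s,t}(\omega)$.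 $\phi$ is a local stochastic flow if for almost all $\omega$: (i) $\phi_{s,s}(\cdot,\omega)=\mathrm{Id}$ for all $s\ge0$; (ii) $\phi_{s,t}(\cdot,\omega):\mathbb{D}_{s,t}(\omega)\to\mathbb{R}_{s,t}(\omega)$ is a homeomorphism for all $0\le s<t$ and the inverse is continuous in $(s,t,x)$; (iii) $\phi_{s,u}(\cdot,\omega)=\phi_{t,u}(\phi_{s,t}(\cdot,\omega),\omega)$ on $\mathbb{D}_{s,u}(\omega)$ for all $0\le s\le t\le u$. The local stochastic flow associated to the SDE is the one (known to exist) for which $t\mapsto\phi_{s,t}(x)$ is the maximal solution of the SDE starting at time $s$ in $x\in\mathbb{R}^2$, with $\mathfrak{e}(s,x)$ its explosion time. The supremum over $t\le T$ of $\phi_t^{(1)}(z)$ is taken over those $t\in[0,T]$ with $t<\mathfrak{e}(0,z)$. *)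

(* Defs.v *)
From HB Require Import structures.
From mathcomp Require Import all_boot all_order all_algebra.
From mathcomp Require Import complex.
From mathcomp Require Import all_classical all_reals all_analysis.
From mathcomp Require Import measurable_realfun.

Set Implicit Arguments.
Unset Strict Implicit.
Unset Printing Implicit Defensive.

Import Order.TTheory GRing.Theory Num.Theory.
Import numFieldNormedType.Exports.

Local Open Scope classical_set_scope.
Local Open Scope ring_scope.

(* Time is [R] restricted to [0 <= t]; no condition constrains any of the
   families below at negative times. *)

Record filtration_usual (R : realType) (d : measure_display)
    (Om : measurableType d) (P : probability Om R)
    (Fil : R -> set_system Om) : Prop := FiltrationUsual {
  filtration_sigma : forall t, 0 <= t -> sigma_algebra setT (Fil t) ;
  filtration_sub : forall t, 0 <= t -> Fil t `<=` measurable ;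
  filtration_mono : forall s t, 0 <= s -> s <= t -> Fil s `<=` Fil t ;
  filtration_right : forall t A, 0 <= t ->
    (forall u, t < u -> Fil u A) -> Fil t A ;
  (* this also makes [(Om, P)] complete *)
  filtration_complete : forall N, P.-negligible N -> Fil 0 N
}.

(* When [G] is a sigma-algebra and [D] belongs to [G], this is Borel
   measurability with respect to [G] of [X] restricted to [D]. *)
Definition borel_on (Om : Type) (E : topologicalType) (G : set_system Om)
    (D : set Om) (X : Om -> E) :=
  forall U : set E, open U -> G (D `&` X @^-1` U).

Definition stopping_time (R : realType) (Om : Type) (Fil : R -> set_system Om)
    (tau : Om -> \bar R) :=
  forall t, 0 <= t -> Fil t [set w | (tau w <= t%:E)%E].

Definition increment (R : realType) (Om : Type) (W : R -> Om -> R)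
    (s t : R) : Om -> R := fun w => W t w - W s w.

Record brownian_motion (R : realType) (d : measure_display)
    (Om : measurableType d) (P : probability Om R)
    (Fil : R -> set_system Om) (W : R -> Om -> R) : Prop := BrownianMotion {
  bm_adapted : forall t, 0 <= t -> borel_on (Fil t) setT (W t) ;
  bm_start : {ae P, forall w, W 0 w = 0} ;
  bm_continuous : {ae P, forall w,
    {within [set t : R | 0 <= t], continuous (fun t => W t w)}} ;
  bm_indep : forall (s t : R) (A : set Om) (B : set R), 0 <= s -> s < t ->
    Fil s A -> measurable B ->
    P (A `&` increment W s t @^-1` B) = (P A * P (increment W s t @^-1` B))%E ;
  (* the second argument of [normal_prob] is the standard deviation *)
  bm_normal : forall (s t : R) (B : set R), 0 <= s -> s < t -> measurable B ->
    P (increment W s t @^-1` B) =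
      normal_prob 0 (Num.sqrt (t - s)) B
}.

Definition process_sigma (R : realType) (Om : Type) (W : R -> Om -> R)
    : set_system Om :=
  <<s [set A | exists t (B : set R),
         [/\ 0 <= t, measurable B & A = W t @^-1` B]] >>.

Definition independent_processes (R : realType) (d : measure_display)
    (Om : measurableType d) (P : probability Om R) (W1 W2 : R -> Om -> R) :=
  forall A B, process_sigma W1 A -> process_sigma W2 B ->
    P (A `&` B) = (P A * P B)%E.

(* [e] is the lifetime and [phi] the random field on the random domain
   [0 <= s <= t < e s x w]; [phi] is a total function whose values off that
   domain are irrelevant. The state space [E] stands for R^d. *)

Definition flow_domain (R : realType) (Om : Type) (E : topologicalType)
    (e : R -> E -> Om -> \bar R) (s t : R) (w : Om) : set E :=
  [set x | (t%:E < e s x w)%E].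

Definition flow_range (R : realType) (Om : Type) (E : topologicalType)
    (e : R -> E -> Om -> \bar R) (phi : R -> R -> E -> Om -> E)
    (s t : R) (w : Om) : set E :=
  (fun x => phi s t x w) @` flow_domain e s t w.

Record local_stochastic_flow (R : realType) (d : measure_display)
    (Om : measurableType d) (P : probability Om R) (E : topologicalType)
    (e : R -> E -> Om -> \bar R) (phi : R -> R -> E -> Om -> E) : Prop :=
    LocalStochasticFlow {
  flow_measurable_lifetime : forall s x, 0 <= s ->
    measurable_fun setT (e s x) ;
  flow_measurable : forall s t x, 0 <= s -> s <= t ->
    borel_on measurable [set w | (t%:E < e s x w)%E] (phi s t x) ;
  flow_lifetime : {ae P, forall w, forall s x, 0 <= s ->
    (s%:E < e s x w)%E} ;
  flow_lsc : {ae P, forall w,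
    lower_semicontinuous
      (fun p : subspace [set p : R * E | 0 <= p.1] => e p.1 p.2 w)} ;
  flow_continuous : {ae P, forall w,
    {within [set p : R * R * E | 0 <= p.1.1 <= p.1.2 /\
               flow_domain e p.1.1 p.1.2 w p.2],
      continuous (fun p : R * R * E => phi p.1.1 p.1.2 p.2 w)}} ;
  flow_id : {ae P, forall w, forall s x, 0 <= s -> phi s s x w = x} ;
  flow_homeo : {ae P, forall w, exists psi : R -> R -> E -> E,
    [/\ forall s t, 0 <= s -> s < t ->
          {in flow_domain e s t w, cancel (fun x => phi s t x w) (psi s t)},
        forall s t, 0 <= s -> s < t ->
          {within flow_domain e s t w, continuous (fun x => phi s t x w)},
        forall s t, 0 <= s -> s < t ->
          {within flow_range e phi s t w, continuous (psi s t)} &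
        {within [set p : R * R * E | (0 <= p.1.1) /\ (p.1.1 < p.1.2) /\
                   flow_range e phi p.1.1 p.1.2 w p.2],
          continuous (fun p : R * R * E => psi p.1.1 p.1.2 p.2)}]} ;
  flow_comp : {ae P, forall w, forall s t u x, 0 <= s -> s <= t -> t <= u ->
    flow_domain e s u w x ->
    (* the first conjunct says that the right-hand side is defined *)
    flow_domain e t u w (phi s t x w) /\
    phi s u x w = phi t u (phi s t x w) w}
}.

(* The SDE  dZ = drift(Z) dt + sigma d(W1, W2)  on R^2 in Cartesian
   coordinates. As [sigma] is constant, the stochastic integral over [s, t]
   is [sigma * (W t - W s)]. [X] is a solution from time [s] and point [x] on
   the stochastic interval [s, tau). *)
Record local_solution (R : realType) (d : measure_display)
    (Om : measurableType d) (P : probability Om R)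
    (Fil : R -> set_system Om) (W1 W2 : R -> Om -> R)
    (drift : R * R -> R * R) (sigma : R) (s : R) (x : R * R)
    (tau : Om -> \bar R) (X : R -> Om -> R * R) : Prop := LocalSolution {
  sol_stopping : stopping_time Fil tau ;
  sol_adapted : forall t, s <= t ->
    borel_on (Fil t) [set w | (t%:E < tau w)%E] (X t) ;
  sol_lifetime : {ae P, forall w, (s%:E < tau w)%E} ;
  sol_continuous : {ae P, forall w,
    {within [set t : R | s <= t /\ (t%:E < tau w)%E],
      continuous (fun t => X t w)}} ;
  sol_equation : {ae P, forall w, forall t, s <= t -> (t%:E < tau w)%E ->
    (X t w).1 = x.1 + \int[lebesgue_measure]_(r in `[s, t]) (drift (X r w)).1
                + sigma * (W1 t w - W1 s w) /\
    (X t w).2 = x.2 + \int[lebesgue_measure]_(r in `[s, t]) (drift (X r w)).2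
                + sigma * (W2 t w - W2 s w)}
}.

Record maximal_solution (R : realType) (d : measure_display)
    (Om : measurableType d) (P : probability Om R)
    (Fil : R -> set_system Om) (W1 W2 : R -> Om -> R)
    (drift : R * R -> R * R) (sigma : R) (s : R) (x : R * R)
    (tau : Om -> \bar R) (X : R -> Om -> R * R) : Prop := MaximalSolution {
  max_solution : local_solution P Fil W1 W2 drift sigma s x tau X ;
  max_extends : forall tau' X',
    local_solution P Fil W1 W2 drift sigma s x tau' X' ->
    {ae P, forall w, (tau' w <= tau w)%E /\
      forall t, s <= t -> (t%:E < tau' w)%E -> X' t w = X t w} ;
  (* [`|_|] is the maximum norm on [R * R] *)
  max_explosion : {ae P, forall w, (tau w < +oo)%E ->
    `|X t w| @[t --> (fine (tau w))^'-] --> +oo}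
}.

Definition toC (R : realType) (z : R * R) : R[i] := Complex z.1 z.2.

Definition poly_drift (R : realType) (n : nat) (F : R[i] -> R[i])
    (z : R * R) : R * R :=
  (complex.Re (toC z ^+ n) + complex.Re (F (toC z)),
   complex.Im (toC z ^+ n) + complex.Im (F (toC z))).

(* [normc] is the [R]-valued modulus; the norm [`|_|] of [R[i]] has values in
   [R[i]]. *)
Definition locally_lipschitzC (R : realType) (F : R[i] -> R[i]) :=
  forall z : R[i], exists r L : R, 0 < r /\
    forall u v : R[i],
      ComplexField.Normc.normc (u - z) < r ->
      ComplexField.Normc.normc (v - z) < r ->
      ComplexField.Normc.normc (F u - F v) <=
        L * ComplexField.Normc.normc (u - v).

Definition bigO_powC (R : realType) (F : R[i] -> R[i]) (k : nat) :=
  exists C K : R, forall z : R[i], K <= ComplexField.Normc.normc z ->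
    ComplexField.Normc.normc (F z) <= C * ComplexField.Normc.normc z ^+ k.

Definition flow_of_sde (R : realType) (d : measure_display)
    (Om : measurableType d) (P : probability Om R)
    (Fil : R -> set_system Om) (W1 W2 : R -> Om -> R)
    (drift : R * R -> R * R) (sigma : R)
    (e : R -> R * R -> Om -> \bar R)
    (phi : R -> R -> R * R -> Om -> R * R) : Prop :=
  local_stochastic_flow P e phi /\
  forall s x, 0 <= s ->
    maximal_solution P Fil W1 W2 drift sigma s x
      (e s x) (fun t => phi s t x).

Definition initial_segment (R : realType) (n : nat) (x0 : R) : set (R * R) :=
  [set x0] `*` `[- (tan (pi / (2 * n%:R)) * x0), tan (pi / (2 * n%:R)) * x0].

Definition sup_first_coord (R : realType) (Om : Type)
    (e : R -> R * R -> Om -> \bar R)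
    (phi : R -> R -> R * R -> Om -> R * R)
    (I : set (R * R)) (T : R) (w : Om) : \bar R :=
  ereal_sup [set ereal_sup [set (phi 0 t z w).1%:E
                           | t in [set t : R | 0 <= t <= T /\
                                     (t%:E < e 0%R z w)%E]]
            | z in I].

(* Main.v *)
Require Import Defs.
From HB Require Import structures.
From mathcomp Require Import all_boot all_order all_algebra.
From mathcomp Require Import complex.
From mathcomp Require Import all_classical all_reals all_analysis.
From mathcomp Require Import measurable_realfun.
From mathcomp Require Import ring lra.

Set Implicit Arguments.
Unset Strict Implicit.
Unset Printing Implicit Defensive.

Import Order.TTheory GRing.Theory Num.Theory.
Import numFieldNormedType.Exports.

Local Open Scope classical_set_scope.
Local Open Scope ring_scope.

(** Why the theorem holds, with [T = 1].

    Since the noise is additive, [U = Z - N] with [N t = sigma * (W t - W 0)]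
    solves, path by path, the random differential equation
    [U' = (U + N)^n + F (U + N)]. On the event that [N] stays below [M] up to
    time [1] this is [U' = U^n] up to an error of order [|U|^(n-1)], and the
    probability of this event tends to [1] as [M] grows
    ([bounded_noise_cvg]). It therefore suffices to show that, for given [M],
    the first coordinate is unbounded over the segment for every large [x0].

    Write [U = (u, v)] and fix a narrow cone [|v| <= kap * u] inside the sector
    [|arg z| <= pi / (2 n)]. For large [u] two facts hold ([cone_drift]):
    in the cone [u' >= u^2 / 2], so that a path which never leaves the cone
    blows up before time [4 / x0] ([cone_finite_time]); and near the ray
    [v = (kap / 2) * u] the angle of [U] grows, because [z^n] turns faster than
    [z], so that a path which is above this ray stays above it until it leaves
    the cone, and symmetrically below the axis.

    Suppose now that the first coordinate is bounded. Then no path can explode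
    or stay in the cone, so each leaves it through its upper or its lower
    boundary ray ([exists_exit]). The two end points of the base of the cone
    leave through different rays, so on a fine enough grid of starting points
    there are two neighbours, one of each kind. The drift is Lipschitz on the
    bounded region where this happens, so by a Gronwall estimate the two paths
    are still close together at the first of the two exit times; the second
    path is then beyond the ray [|v| = (kap / 2) * u] on the side where the
    first one leaves, and cannot leave on the other side
    ([opposite_exits_apart]). This contradiction is [some_path_unbounded].

    Only countably many starting points, the grid points, enter the argument.
    The equation and the explosion property hold outside a null set which
    depends on the starting point, so that they are not available for all
    points of the segment at once, and in particular not for the random
    starting point from which the solution really explodes inside the cone.

    Finally the event in the theorem is measurable up to a null set, because
    lower semicontinuity of the lifetime and joint continuity of the flow
    reduce the suprema to countable ones ([measurable_sup_infinite]); the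
    probability space being complete, it is measurable. *)

(** * Barriers and a Gronwall estimate on an interval *)

Section RealFunctions.
Context {R : realType}.
Implicit Types (f g df dg : R -> R) (a b s t : R).

Lemma within_continuous_eps f (A : set R) t (eps : R) :
  {within A, continuous f} -> A t -> 0 < eps ->
  exists2 del, 0 < del &
    forall r, A r -> `|r - t| < del -> `|f r - f t| < eps.
Proof.
move=> cf At eps0.
have /subspace_continuousP/(_ t At) := cf.
move=> /cvgrPdist_lt/(_ _ eps0) /nbhs_ballP[del /= del0 H].
exists del => // r Ar rt; rewrite distrC; apply: H => //.
by rewrite /ball /= distrC.
Qed.

(** The zero is the infimum of the times at which [f <= 0]. *)
Lemma first_zero f a b : a <= b -> {within `[a, b], continuous f} ->
  0 <= f a -> f b <= 0 ->
  exists t, [/\ a <= t <= b, f t = 0 & forall r, a <= r <= t -> 0 <= f r].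
Proof.
move=> ab cf; rewrite le_eqVlt => /predU1P[fa0 _|fa fb].
  exists a; split; rewrite ?lexx ?ab // => r; rewrite -eq_le => /eqP <-.
  by rewrite -fa0.
pose A := [set t | a <= t <= b /\ f t <= 0].
have Ab : A b by rewrite /A /= lexx ab.
have hA : has_inf A.
  by split; [exists b|exists a => t [] /andP[]].
have ait : a <= inf A by apply: lb_le_inf; [exists b|move=> t [] /andP[]].
have itb : inf A <= b by apply: ge_inf => //; exists a => t [] /andP[].
have iI : [set` `[a, b]] (inf A) by rewrite /= in_itv /= ait itb.
have lowA r : a <= r -> r < inf A -> 0 < f r.
  move=> ar rA; rewrite ltNge; apply/negP => fr.
  have : inf A <= r.
    apply: ge_inf; first by exists a => t [] /andP[].
    by split=> //; rewrite ar (le_trans (ltW rA)).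
  by rewrite leNgt rA.
have fi0 : f (inf A) <= 0.
  rewrite leNgt; apply/negP => fi.
  have [del del0 H] := within_continuous_eps cf iI fi.
  have [r Ar rlt] := inf_adherent del0 hA.
  have iAr : inf A <= r by apply: ge_inf => //; exists a => t [] /andP[].
  case: Ar => rab fr.
  have rI : [set` `[a, b]] r by rewrite /= in_itv.
  have rd : `|r - inf A| < del by rewrite ger0_norm ?subr_ge0 // ltrBlDl.
  by have := H r rI rd; rewrite distrC => /ltr_normlW; lra.
have fi0' : 0 <= f (inf A).
  rewrite leNgt; apply/negP => fi.
  have ai : a < inf A.
    by rewrite lt_neqAle ait andbT; apply/eqP => ai; move: fi; rewrite -ai; lra.
  have nfi : 0 < - f (inf A) by lra.
  have [del del0 H] := within_continuous_eps cf iI nfi.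
  pose r := Num.max a (inf A - del / 2).
  have ra : a <= r by rewrite le_max lexx.
  have rA : r < inf A by rewrite gt_max ai; lra.
  have fr := lowA r ra rA.
  have rI : [set` `[a, b]] r by rewrite /= in_itv /= ra (ltW (lt_le_trans rA itb)).
  have rd : `|r - inf A| < del.
    have : inf A - del / 2 <= r by rewrite le_max lexx orbT.
    by rewrite ltr0_norm ?subr_lt0 //; lra.
  by have := ltr_normlW (H r rI rd); lra.
exists (inf A); split; [by rewrite ait itb|by apply/eqP; rewrite eq_le fi0|].
move=> r /andP[ar]; rewrite le_eqVlt => /predU1P[->//|/(lowA _ ar)/ltW//].
Qed.

(** A function differentiable inside an interval and continuous up to its end
    points: the paths start at time [0], where only one-sided information is
    available. *)
Definition diff_on a b f df :=
  {within `[a, b], continuous f} /\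
  forall r, a < r < b -> is_derive r 1 f (df r).

Lemma diff_onS a b s t f df : a <= s -> t <= b ->
  diff_on a b f df -> diff_on s t f df.
Proof.
move=> as_ tb [cf df_]; split.
  by apply: continuous_subspaceW cf; apply: subset_itvScc; rewrite ?bnd_simp.
move=> r /andP[sr rt]; apply: df_.
by rewrite (le_lt_trans as_ sr) (lt_le_trans rt tb).
Qed.

Lemma diff_onN a b f df : diff_on a b f df ->
  diff_on a b (fun r => - f r) (fun r => - df r).
Proof.
move=> [cf df_]; split=> [x|r /df_ fr]; first exact/continuousN/cf.
exact: is_deriveN.
Qed.

Lemma diff_onD a b f df g dg : diff_on a b f df -> diff_on a b g dg ->
  diff_on a b (fun r => f r + g r) (fun r => df r + dg r).
Proof.
move=> [cf df_] [cg dg_]; split=> [x|r rab].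
  by apply: continuousD; [exact: cf|exact: cg].
by have fr := df_ r rab; have gr := dg_ r rab; exact: is_deriveD.
Qed.

Lemma diff_onZ a b c f df : diff_on a b f df ->
  diff_on a b (fun r => c * f r) (fun r => c * df r).
Proof.
move=> [cf df_]; split=> [x|r rab].
  by apply: (@continuousM _ (subspace `[a, b]) (cst c) f); [exact: cvg_cst|exact: cf].
by have fr := df_ r rab; exact: is_deriveZ.
Qed.

Lemma diff_on_cst a b c : diff_on a b (fun=> c) (fun=> 0).
Proof.
by split=> [x|r _]; [exact: cvg_cst|exact: is_derive_cst].
Qed.

Lemma diff_onM a b f df g dg : diff_on a b f df -> diff_on a b g dg ->
  diff_on a b (fun r => f r * g r) (fun r => f r * dg r + g r * df r).
Proof.
move=> [cf df_] [cg dg_]; split=> [x|r rab].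
  by apply: (@continuousM _ (subspace `[a, b])); [exact: cf|exact: cg].
by have fr := df_ r rab; have gr := dg_ r rab; exact: is_deriveM.
Qed.

Lemma diff_on_incr a b f df : a <= b -> diff_on a b f df ->
  (forall r, a < r < b -> 0 <= df r) -> f a <= f b.
Proof.
move=> ab [cf dfr] df0.
have dfr' x : x \in `]a, b[%R -> is_derive x 1 f (df x).
  by rewrite in_itv; exact: dfr.
have: a < b \/ a = b by move: ab; rewrite le_eqVlt => /predU1P[|]; tauto.
case=> [{}ab|->//].
have [c cab] := MVT ab dfr' cf.
have c0 := df0 c cab; rewrite -subr_ge0 => ->.
by rewrite mulr_ge0 // subr_ge0 ltW.
Qed.

(** The sign of the derivative is needed only in a thin layer below [0], which
    a continuous function has to cross before it gets far below. *)
Lemma barrier a b f df eps : a <= b -> diff_on a b f df -> 0 <= f a ->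
  0 < eps -> (forall r, a < r < b -> - eps < f r < 0 -> 0 <= df r) ->
  0 <= f b.
Proof.
move=> ab dfab fa eps0 df0; rewrite leNgt; apply/negP => fb.
pose A := [set t | a <= t <= b /\ 0 <= f t].
have Aa : A a by rewrite /A /= lexx ab.
have Ab t : A t -> t <= b by case=> /andP[].
have sA : has_sup A by split; [exists a|exists b => t /Ab].
have ais : a <= sup A by apply: ub_le_sup => //; exists b => t /Ab.
have sib : sup A <= b by apply: ge_sup; [exists a|move=> t /Ab].
have isA : [set` `[a, b]] (sup A) by rewrite /= in_itv /= ais sib.
have fs : 0 <= f (sup A).
  rewrite leNgt; apply/negP => fi.
  have nfi : 0 < - f (sup A) by lra.
  have [del del0 H] := within_continuous_eps dfab.1 isA nfi.
  have [r Ar rlt] := sup_adherent del0 sA.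
  have iAr : r <= sup A by apply: ub_le_sup => //; exists b => t /Ab.
  case: Ar => rab fr.
  have rI : [set` `[a, b]] r by rewrite /= in_itv.
  have rd : `|r - sup A| < del by rewrite ler0_norm ?subr_le0 //; lra.
  by have := ltr_normlW (H r rI rd); lra.
have sb : sup A < b.
  by rewrite lt_neqAle sib andbT; apply/eqP => e; move: fs; rewrite e; lra.
have fneg r : sup A < r -> r <= b -> f r < 0.
  move=> sr rb; rewrite ltNge; apply/negP => fr.
  have : r <= sup A.
    apply: ub_le_sup; first by exists b => t /Ab.
    by split=> //; rewrite rb (le_trans ais (ltW sr)).
  by rewrite leNgt sr.
have [del del0 H] := within_continuous_eps dfab.1 isA eps0.
pose r := Num.min b (sup A + del / 2).
have sr : sup A < r by rewrite lt_min sb; lra.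
have rb : r <= b by rewrite ge_min lexx.
have rd : r <= sup A + del / 2 by rewrite ge_min lexx orbT.
have := fneg r sr rb; suff : f (sup A) <= f r by lra.
apply: (diff_on_incr (ltW sr) (diff_onS ais rb dfab)) => x /andP[sx xr].
apply: df0; first by rewrite (le_lt_trans ais sx) (lt_le_trans xr rb).
have xb : x <= b by lra.
rewrite (fneg x sx xb) andbT.
have xI : [set` `[a, b]] x by rewrite /= in_itv /= (le_trans ais (ltW sx)).
have xd : `|x - sup A| < del by rewrite gtr0_norm ?subr_gt0 //; lra.
by have := H x xI xd; rewrite ltr_norml => /andP[]; lra.
Qed.

Lemma diff_on_eq a b f df g dg : diff_on a b f df -> f =1 g ->
  (forall r, a < r < b -> df r = dg r) -> diff_on a b g dg.
Proof.
move=> [cf df_] /funext <- e; split=> // r rab.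
by rewrite -e //; exact: df_.
Qed.

Lemma diff_on_exp a b c :
  diff_on a b (fun r => expR (c * r)) (fun r => c * expR (c * r)).
Proof.
have de (r : R) : is_derive r 1 (fun r : R => expR (c * r)) (c * expR (c * r)).
  have dc : is_derive r 1 (fun r : R => c * r) c.
    have := @is_deriveZ _ _ _ (id : R -> R) c r 1 1 (is_derive_id _ _).
    by rewrite /GRing.scale /= mulr1.
  have := @is_derive1_comp _ expR _ r _ _ (is_derive_expR (c * r)) dc.
  by rewrite mulrC.
split=> // x; apply: continuous_subspaceT => y.
have [/derivable1_diffP/differentiable_continuous] := de y.
by [].
Qed.

(** The derivative of [f ^+ 2 + g ^+ 2] is at most [2 * L * (|f| + |g|) ^+ 2],
    hence at most [4 * L] times the function itself. *)
Lemma gronwall2 t L f df g dg : 0 <= t -> 0 <= L ->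
  diff_on 0 t f df -> diff_on 0 t g dg ->
  (forall r, 0 < r < t -> `|df r| <= L * (`|f r| + `|g r|)) ->
  (forall r, 0 < r < t -> `|dg r| <= L * (`|f r| + `|g r|)) ->
  f t ^+ 2 + g t ^+ 2 <= expR (4 * L * t) * (f 0 ^+ 2 + g 0 ^+ 2).
Proof.
move=> t0 L0 df_ dg_ fL gL.
have dE := diff_onM (diff_on_exp 0 t (- (4 * L)))
  (diff_onD (diff_onM df_ df_) (diff_onM dg_ dg_)).
have dpos : forall r, 0 < r < t -> 0 <=
    - (expR (- (4 * L) * r) * (f r * df r + f r * df r + (g r * dg r + g r * dg r)) +
   (f r * f r + g r * g r) * (- (4 * L) * expR (- (4 * L) * r))).
  move=> r rt.
  have fr := fL r rt; have gr := gL r rt.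
  rewrite (_ : - _ = expR (- (4 * L) * r) *
    (4 * L * (f r ^+ 2 + g r ^+ 2) - 2 * (f r * df r + g r * dg r))); last by ring.
  rewrite mulr_ge0 ?expR_ge0 // subr_ge0.
  have h1 : f r * df r <= `|f r| * (L * (`|f r| + `|g r|)).
    by rewrite (le_trans (ler_norm _)) // normrM ler_wpM2l.
  have h2 : g r * dg r <= `|g r| * (L * (`|f r| + `|g r|)).
    by rewrite (le_trans (ler_norm _)) // normrM ler_wpM2l.
  rewrite -(real_normK (num_real (f r))) -(real_normK (num_real (g r))).
  have LE : 0 <= L * (`|f r| - `|g r|) ^+ 2 by rewrite mulr_ge0 // sqr_ge0.
  have : 4 * L * (`|f r| ^+ 2 + `|g r| ^+ 2) - 2 * (`|f r| * (L * (`|f r| + `|g r|)) + `|g r| * (L * (`|f r| + `|g r|))) = 2 * (L * (`|f r| - `|g r|) ^+ 2) by ring.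
  by lra.
have := diff_on_incr t0 (diff_onN dE) dpos.
rewrite mulr0 expR0 mul1r lerNl opprK mulNr expRN -!expr2 mulrC.
by rewrite ler_pdivrMr ?expR_gt0 // [X in _ <= X]mulrC.
Qed.

End RealFunctions.

(** * Paths in a cone *)

Section Cone.
Context {R : realType}.
Implicit Types (b : R -> R -> R) (n u v : R -> R) (kap X M B L d r s t x y h k : R).

(** [(u, v)] is the position minus the noise [(n1, n2)]: unlike the position
    itself it is differentiable. *)
Definition noisy_path b1 b2 n1 n2 t u v :=
  diff_on 0 t u (fun r => b1 (u r + n1 r) (v r + n2 r)) /\
  diff_on 0 t v (fun r => b2 (u r + n1 r) (v r + n2 r)).

Definition in_cone kap u v t :=
  forall r, 0 <= r <= t -> `|v r| <= kap * u r.

Definition noise_bound M n1 n2 :=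
  forall r, 0 <= r <= 1 -> `|n1 r| <= M /\ `|n2 r| <= M.

Definition lip_box b1 b2 B L := forall x y x' y',
  `|x| <= B -> `|y| <= B -> `|x'| <= B -> `|y'| <= B ->
  `|b1 x y - b1 x' y'| <= L * (`|x - x'| + `|y - y'|) /\
  `|b2 x y - b2 x' y'| <= L * (`|x - x'| + `|y - y'|).

Definition pushes_right b1 kap X M := forall x y h k,
  X <= x -> `|y| <= kap * x -> `|h| <= M -> `|k| <= M ->
  x ^+ 2 / 2 <= b1 (x + h) (y + k).

(** What [barrier] asks for in order that paths cannot cross the ray of slope
    [kap / 2] downwards: in a layer below this ray, [v - kap / 2 * u] does not
    decrease. *)
Definition pushes_up b1 b2 kap X M := forall x y h k,
  X <= x -> 3 / 8 * kap * x <= y <= kap / 2 * x -> `|h| <= M -> `|k| <= M ->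
  kap / 2 * b1 (x + h) (y + k) <= b2 (x + h) (y + k).

Lemma noisy_pathS b1 b2 n1 n2 s t u v : s <= t ->
  noisy_path b1 b2 n1 n2 t u v -> noisy_path b1 b2 n1 n2 s u v.
Proof. by move=> st [pu pv]; split; apply: diff_onS (lexx 0) st _. Qed.

(** The barrier [u 0] cannot be crossed downwards: just below it, [u] is still
    at least [X] and the drift points to the right. *)
Lemma cone_advance b1 b2 n1 n2 u v kap X M t :
  pushes_right b1 kap X M -> noise_bound M n1 n2 -> t <= 1 ->
  noisy_path b1 b2 n1 n2 t u v -> in_cone kap u v t -> X < u 0 ->
  forall r, 0 <= r <= t -> u 0 <= u r.
Proof.
move=> hb hn t1 puv uv Xu r /andP[r0 rt].
have rt1 : r <= 1 := le_trans rt t1.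
have [pu _] := noisy_pathS rt puv.
have e0 : 0 < u 0 - X by lra.
rewrite -subr_ge0.
apply: (barrier r0 (diff_onD pu (diff_on_cst 0 r (- u 0))) _ e0); first by rewrite subrr.
move=> x /andP[x0 xr] /andP[xl _].
have [|a1 a2] := hn x; first by lra.
rewrite addr0; apply: le_trans (hb _ _ _ _ _ _ a1 a2); last 2 first.
- by lra.
- by apply: uv; lra.
by rewrite divr_ge0 ?sqr_ge0.
Qed.

(** While the path stays in the cone, [u' >= u^2 / 2]; the product
    [u r * (1 - u 0 * r / 4)] then never falls below [u 0], although its second
    factor vanishes at the time [4 / u 0]. *)
Lemma cone_finite_time b1 b2 n1 n2 u v kap X M :
  pushes_right b1 kap X M -> noise_bound M n1 n2 -> 0 < X ->
  noisy_path b1 b2 n1 n2 (4 / u 0) u v -> in_cone kap u v (4 / u 0) ->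
  X < u 0 -> 4 <= u 0 -> False.
Proof.
move=> hb hn X0 puv uv Xu u4.
set T := 4 / u 0 in puv uv *.
have u0 : 0 < u 0 by lra.
have T1 : T <= 1 by rewrite ler_pdivrMr // mul1r.
have T0 : 0 <= T by rewrite divr_ge0 // ltW.
have uT : u 0 * T = 4 by rewrite mulrC divfK // gt_eqF.
have adv := cone_advance hb hn T1 puv uv Xu.
have dline : diff_on 0 T (fun r => 1 - u 0 / 4 * r) (fun=> - (u 0 / 4)).
  have did : diff_on 0 T (id : R -> R) (fun=> 1).
    split=> [|r _]; last exact: is_derive_id.
    by apply: continuous_subspaceT => x; exact: cvg_id.
  apply: (diff_on_eq (diff_onD (diff_on_cst 0 T 1) (diff_onN (diff_onZ (u 0 / 4) did)))) => //.
  by move=> r _; rewrite mulr1 add0r.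
have dprod := diff_onD (diff_onM puv.1 dline) (diff_on_cst 0 T (- u 0)).
have e0 : 0 < u 0 / 2 by lra.
have := barrier T0 dprod _ e0 => /=.
rewrite mulr0 subr0 mulr1 subrr lexx => /(_ isT).
suff h : forall r, 0 < r < T -> - (u 0 / 2) < u r * (1 - u 0 / 4 * r) + - u 0 < 0 ->
    0 <= u r * - (u 0 / 4) + (1 - u 0 / 4 * r) * b1 (u r + n1 r) (v r + n2 r) + 0.
  move=> /(_ h); rewrite mulrAC uT divff // subrr mulr0; lra.
move=> r /andP[r0 rT] /andP[lo _].
have [|a1 a2] := hn r; first by lra.
have ur : u 0 <= u r by apply: adv; lra.
have b1r : u r ^+ 2 / 2 <= b1 (u r + n1 r) (v r + n2 r).
  by apply: hb => //; [lra|apply: uv; lra].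
have l0 : 0 <= 1 - u 0 / 4 * r.
  have : u 0 * r <= u 0 * T by rewrite ler_wpM2l // ltW.
  by lra.
have h1 := ler_wpM2l l0 b1r.
have h2 : 0 <= u r / 2 * (u r * (1 - u 0 / 4 * r) - u 0 / 2).
  by rewrite mulr_ge0 //; lra.
have e : u r / 2 * (u r * (1 - u 0 / 4 * r) - u 0 / 2) =
  u r * - (u 0 / 4) + (1 - u 0 / 4 * r) * (u r ^+ 2 / 2) by field.
by lra.
Qed.

(** Up to time [s] both paths lie in a box on which the drift is [L]-Lipschitz,
    so at time [s] their distance is at most [kap * X / 4] in each coordinate.
    As the first path is then on the ray of slope [kap], the second one is above
    the ray of slope [kap / 2], which is a barrier for it from then on. *)
Lemma upper_exit_attracts b1 b2 n1 n2 u v u' v' kap X M B L d s t :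
  pushes_right b1 kap X M -> pushes_up b1 b2 kap X M ->
  noise_bound M n1 n2 -> lip_box b1 b2 (B + M) L ->
  0 < X -> 0 < kap <= 1 -> 0 <= L -> 0 <= s <= t -> t <= 1 ->
  noisy_path b1 b2 n1 n2 s u v -> noisy_path b1 b2 n1 n2 t u' v' ->
  in_cone kap u v s -> in_cone kap u' v' t -> X < u 0 -> u 0 = u' 0 ->
  (forall r, 0 <= r <= s -> u r <= B) -> (forall r, 0 <= r <= t -> u' r <= B) ->
  `|v 0 - v' 0| <= d -> 16 * (expR (4 * L) * d ^+ 2) <= (kap * X) ^+ 2 ->
  v s = kap * u s -> 0 < v' t.
Proof.
move=> hb hup hn hL X0 /andP[k0 k1] L0 /andP[s0 st] t1 p p' c c' Xu u00 uB uB' vd hd vs.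
have Xu' : X < u' 0 by rewrite -u00.
have s1 := le_trans st t1.
have adv := cone_advance hb hn s1 p c Xu.
have adv' := cone_advance hb hn t1 p' c' Xu'.
have p's := noisy_pathS st p'.
have box (x y : R) : `|y| <= kap * x -> x <= B -> `|x| <= B /\ `|y| <= B.
  move=> yx xB.
  have x0 : 0 <= x by rewrite -(pmulr_rge0 _ k0) (le_trans (normr_ge0 _) yx).
  split; first by rewrite ger0_norm.
  by rewrite (le_trans yx) // (le_trans _ xB) // ler_piMl.
have lip (r : R) : 0 < r < s ->
    `|b1 (u r + n1 r) (v r + n2 r) - b1 (u' r + n1 r) (v' r + n2 r)| <=
      L * (`|u r - u' r| + `|v r - v' r|) /\
    `|b2 (u r + n1 r) (v r + n2 r) - b2 (u' r + n1 r) (v' r + n2 r)| <=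
      L * (`|u r - u' r| + `|v r - v' r|).
  move=> /andP[r0 rs].
  have [|a1 a2] := hn r; first by lra.
  have [||xu yv] := box (u r) (v r); [by apply: c; lra|by apply: uB; lra|].
  have [||xu' yv'] := box (u' r) (v' r); [by apply: c'; lra|by apply: uB'; lra|].
  have := hL (u r + n1 r) (v r + n2 r) (u' r + n1 r) (v' r + n2 r).
  have add (x a : R) : `|x| <= B -> `|a| <= M -> `|x + a| <= B + M.
    by move=> xB aM; rewrite (le_trans (ler_normD _ _)) // lerD.
  have cancel (x y z : R) : x + z - (y + z) = x - y :> R by ring.
  by rewrite !add // !cancel => /(_ isT isT isT isT).
have := gronwall2 s0 L0 (diff_onD p.1 (diff_onN p's.1))
  (diff_onD p.2 (diff_onN p's.2)) (fun r rs => (lip r rs).1) (fun r rs => (lip r rs).2).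
rewrite u00 subrr expr0n add0r => hE.
have {hE} : 16 * ((u s - u' s) ^+ 2 + (v s - v' s) ^+ 2) <= (kap * X) ^+ 2.
  apply: le_trans hd; rewrite ler_wpM2l //; apply: le_trans hE _.
  apply: ler_pM; rewrite ?expR_ge0 ?sqr_ge0 //.
    by rewrite ler_expR ler_piMr // mulr_ge0.
  by rewrite -(real_normK (num_real (v 0 - v' 0))) ler_pXn2r // nnegrE ?(le_trans _ vd).
have kX : 0 <= kap * X by rewrite mulr_ge0 // ltW.
have sq (x y : R) : 0 <= y -> 16 * x ^+ 2 <= y ^+ 2 -> `|x| <= y / 4.
  move=> y0 xy; rewrite -(@ler_pXn2r _ 2) // ?nnegrE ?divr_ge0 //.
  rewrite real_normK ?num_real // expr_div_n ler_pdivlMr; last by rewrite exprn_gt0.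
  by apply: le_trans xy; rewrite mulrC ler_wpM2r ?sqr_ge0 // -natrX ler_nat.
move=> hE.
have hf : `|u s - u' s| <= kap * X / 4.
  by apply: sq => //; apply: le_trans hE; rewrite ler_wpM2l // lerDl sqr_ge0.
have hg : `|v s - v' s| <= kap * X / 4.
  by apply: sq => //; apply: le_trans hE; rewrite ler_wpM2l // lerDr sqr_ge0.
have u's : X < u' s by apply: lt_le_trans Xu' (adv' s _); rewrite s0.
have up_s : 0 <= v' s - kap / 2 * u' s.
  have kf : `|kap * (u s - u' s)| <= kap * X / 4.
    rewrite normrM (gtr0_norm k0) (le_trans _ hf) // ler_piMl //.
  move: kf hg; rewrite !ler_norml vs => /andP[? ?] /andP[? ?].
  have : kap * X <= kap * u' s by rewrite ler_wpM2l // ltW.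
  by lra.
have up_t : 0 <= v' t - kap / 2 * u' t.
  have [pu' pv'] := p'.
  have kX8 : 0 < kap * X / 8 by rewrite divr_gt0 // mulr_gt0.
  have dv := diff_onS s0 (lexx t)
    (diff_onD pv' (diff_onN (diff_onZ (kap / 2) pu'))).
  apply: (barrier st dv up_s kX8) => r /andP[sr rt] /andP[lo hi].
  have r0t : 0 <= r <= t by lra.
  have [|a1 a2] := hn r; first by lra.
  have Xr : X <= u' r by apply: ltW (lt_le_trans Xu' (adv' r r0t)).
  rewrite subr_ge0; apply: hup => //.
  have : kap * X <= kap * u' r by rewrite ler_wpM2l // ltW.
  by lra.
have u't : 0 < u' t by apply: lt_trans X0 (lt_le_trans Xu' (adv' t _)); lra.
have : 0 < kap / 2 * u' t by rewrite mulr_gt0 // divr_gt0.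
by lra.
Qed.

End Cone.

(** * Exits from the cone *)

Section ConeEscape.
Context {R : realType}.
Implicit Types (b : R -> R -> R) (n u v : R -> R).
Implicit Types (kap X M B L d r s t x y h : R).

Definition grid (m k : nat) : R := - 1 + 2 * k%:R / m.+1%:R.

(** [side] is [1] for the upper and [-1] for the lower boundary ray. *)
Definition exits (tau : \bar R) kap u v (side t : R) :=
  [/\ 0 <= t <= 1, (t%:E < tau)%E, in_cone kap u v t & v t = side * (kap * u t)].

(** A path which reaches neither boundary ray stays in the cone. There the bound
    on [u] bounds [v] as well and excludes an explosion up to time [1], so the
    path lives at least until [4 / u 0], against [cone_finite_time]. *)
Lemma exists_exit b1 b2 n1 n2 u v kap X M S (tau : \bar R) :
  pushes_right b1 kap X M -> noise_bound M n1 n2 ->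
  0 < X -> 0 < kap <= 1 -> X < u 0 -> 4 <= u 0 -> `|v 0| <= kap * u 0 ->
  (0 < tau)%E ->
  (forall t, 0 <= t -> (t%:E < tau)%E -> noisy_path b1 b2 n1 n2 t u v) ->
  ((tau <= 1%:E)%E -> forall rho, exists t,
    [/\ 0 <= t, (t%:E < tau)%E & rho < `|u t| + `|v t|]) ->
  (forall t, 0 <= t <= 1 -> (t%:E < tau)%E -> u t <= S) ->
  exists t, exits tau kap u v 1 t \/ exits tau kap u v (-1) t.
Proof.
move=> hb hn X0 /andP[k0 k1] Xu u4 v0 tau0 path blow uS.
apply: contrapT => /forallNP noexit.
have inside t : 0 <= t <= 1 -> (t%:E < tau)%E -> `|v t| <= kap * u t.
  move=> /andP[t0 t1] ttau; rewrite -subr_ge0 leNgt; apply/negP => ht.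
  have [pu pv] := path t t0 ttau.
  have [|||s [/andP[s0 st] hs cs]] := @first_zero _ (fun r => kap * u r - `|v r|) 0 t t0.
  - move=> x; apply: (@continuousB _ _ (subspace `[0, t]) (fun r => kap * u r) (fun r => `|v r|)); first exact: (diff_onZ kap pu).1.
    by apply: continuous_comp; [exact: pv.1|exact: norm_continuous].
  - by rewrite subr_ge0.
  - exact: ltW.
  have stau : (s%:E < tau)%E by apply: le_lt_trans ttau; rewrite lee_fin.
  have s1 : s <= 1 := le_trans st t1.
  have cone_s : in_cone kap u v s by move=> r /cs; rewrite subr_ge0.
  have vs : `|v s| = kap * u s by lra.
  apply: (noexit s).
  have [v_ge0|v_lt0] := leP 0 (v s); [left|right]; split; rewrite ?s0 ?s1 //.
    by rewrite mul1r -vs ger0_norm.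
  by rewrite -vs ltr0_norm // mulN1r opprK.
have u_ge0 t : 0 <= t <= 1 -> (t%:E < tau)%E -> 0 <= u t.
  by move=> t01 ttau; rewrite -(pmulr_rge0 _ k0) (le_trans _ (inside t t01 ttau)).
have tau1 : (1%:E < tau)%E.
  rewrite ltNge; apply/negP => tau1.
  have [t [t0 ttau]] := blow tau1 (2 * S).
  have t01 : 0 <= t <= 1.
    by rewrite t0 -lee_fin (le_trans (ltW ttau)).
  have := inside t t01 ttau; have := uS t t01 ttau; have ut := u_ge0 t t01 ttau.
  have : kap * u t <= u t by rewrite ler_piMl.
  by rewrite (ger0_norm ut); lra.
have T1 : 4 / u 0 <= 1 by rewrite ler_pdivrMr ?mul1r //; lra.
have T0 : 0 <= 4 / u 0 by rewrite divr_ge0 //; lra.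
have cone_T : in_cone kap u v (4 / u 0).
  move=> r /andP[r0 rT]; have r1 := le_trans rT T1.
  by apply: inside; rewrite ?r0 ?r1 // (le_lt_trans _ tau1) // lee_fin.
apply: (cone_finite_time hb hn X0 (path _ T0 _) cone_T Xu u4).
by rewrite (le_lt_trans _ tau1) // lee_fin.
Qed.

(** Complex conjugation exchanges the two boundary rays of the cone, and so lets
    [upper_exit_attracts] serve for both. *)
Lemma noisy_path_conj b1 b2 n1 n2 t u v : noisy_path b1 b2 n1 n2 t u v ->
  noisy_path (fun x y => b1 x (- y)) (fun x y => - b2 x (- y))
    n1 (fun r => - n2 r) t u (fun r => - v r).
Proof.
move=> [pu pv]; split.
  by apply: (diff_on_eq pu) => // r _; rewrite opprD !opprK.
by apply: (diff_on_eq (diff_onN pv)) => // r _; rewrite opprD !opprK.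
Qed.

Lemma in_cone_conj kap u v t :
  in_cone kap u v t -> in_cone kap u (fun r => - v r) t.
Proof. by move=> c r /c; rewrite normrN. Qed.

(** Whichever exit comes first attracts the other path to its side. *)
Lemma opposite_exits_apart b1 b2 n1 n2 u v u' v' kap X M B L d
    (tau tau' : \bar R) s t :
  pushes_right b1 kap X M -> pushes_up b1 b2 kap X M ->
  pushes_up (fun x y => b1 x (- y)) (fun x y => - b2 x (- y)) kap X M ->
  noise_bound M n1 n2 -> lip_box b1 b2 (B + M) L ->
  0 < X -> 0 < kap <= 1 -> 0 <= L ->
  (forall t, 0 <= t -> (t%:E < tau)%E -> noisy_path b1 b2 n1 n2 t u v) ->
  (forall t, 0 <= t -> (t%:E < tau')%E -> noisy_path b1 b2 n1 n2 t u' v') ->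
  X < u 0 -> u 0 = u' 0 ->
  (forall r, 0 <= r <= 1 -> (r%:E < tau)%E -> u r <= B) ->
  (forall r, 0 <= r <= 1 -> (r%:E < tau')%E -> u' r <= B) ->
  `|v 0 - v' 0| <= d -> 16 * (expR (4 * L) * d ^+ 2) <= (kap * X) ^+ 2 ->
  exits tau kap u v 1 s -> exits tau' kap u' v' (-1) t -> False.
Proof.
move=> hb hup hdown hn hL X0 hk L0 p p' Xu uu uB uB' vd hd.
move=> [/andP[s0 s1] stau c vs] [/andP[t0 t1] ttau c' vt].
have [k0 _] := andP hk.
have Xu' : X < u' 0 by rewrite -uu.
have us : 0 < u s.
  have := cone_advance hb hn s1 (p _ s0 stau) c Xu (r := s).
  by rewrite s0 lexx => /(_ isT); lra.
have ut : 0 < u' t.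
  have := cone_advance hb hn t1 (p' _ t0 ttau) c' Xu' (r := t).
  by rewrite t0 lexx => /(_ isT); lra.
have bd a (tau0 : \bar R) w : a <= 1 -> (a%:E < tau0)%E ->
    (forall r, 0 <= r <= 1 -> (r%:E < tau0)%E -> w r <= B) ->
    forall r, 0 <= r <= a -> w r <= B.
  move=> a1 atau wB r /andP[r0 ra]; apply: wB; first by rewrite r0 (le_trans ra).
  by rewrite (le_lt_trans _ atau) // lee_fin.
have Bs := bd _ _ _ s1 stau uB.
have Bt := bd _ _ _ t1 ttau uB'.
have [st|ts] := leP s t.
  have st' : 0 <= s <= t by rewrite s0.
  have := upper_exit_attracts hb hup hn hL X0 hk L0 st' t1 (p _ s0 stau)
    (p' _ t0 ttau) c c' Xu uu Bs Bt vd hd.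
  rewrite vs vt mul1r => /(_ erefl).
  have := mulr_gt0 k0 ut; lra.
have ts' : 0 <= t <= s by rewrite t0 ltW.
have hb' : pushes_right (fun x y => b1 x (- y)) kap X M.
  by move=> x y h k Xx yx hM kM; rewrite opprD; apply: hb; rewrite ?normrN.
have hn' : noise_bound M n1 (fun r => - n2 r).
  by move=> r /hn; rewrite normrN.
have hL' : lip_box (fun x y => b1 x (- y)) (fun x y => - b2 x (- y)) (B + M) L.
  move=> x y x' y' xB yB x'B y'B.
  have := hL x (- y) x' (- y'); rewrite !normrN => /(_ xB yB x'B y'B).
  by rewrite -!opprD !normrN.
have vd' : `|- v' 0 - - v 0| <= d by rewrite opprK addrC.
have := upper_exit_attracts hb' hdown hn' hL' X0 hk L0 ts' s1
  (noisy_path_conj (p' _ t0 ttau)) (noisy_path_conj (p _ s0 stau))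
  (in_cone_conj c') (in_cone_conj c) Xu' (esym uu) Bt Bs vd' hd.
rewrite vs vt mulN1r opprK mul1r => /(_ erefl).
have := mulr_gt0 k0 us; lra.
Qed.

Lemma grid_bound m k : (k <= m.+1)%N -> `|grid m k| <= 1.
Proof.
move=> km; rewrite /grid ler_norml.
have h0 : 0 <= k%:R / m.+1%:R :> R by rewrite divr_ge0.
have h1 : k%:R / m.+1%:R <= 1 :> R by rewrite ler_pdivrMr ?ltr0n // mul1r ler_nat.
by rewrite -mulrA; move: h0 h1; move: (_ / _) => z; lra.
Qed.

(** Otherwise every grid path has an exit. The path from [grid m 0] starts on the
    lower ray, and from a lower exit at one grid point follows a lower exit at
    the next, until [grid m m.+1], which starts on the upper ray. *)
Lemma some_path_unbounded b1 b2 n1 n2 kap X M x0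
    (u v : R -> R -> R) (tau : R -> \bar R) :
  pushes_right b1 kap X M -> pushes_up b1 b2 kap X M ->
  pushes_up (fun x y => b1 x (- y)) (fun x y => - b2 x (- y)) kap X M ->
  (forall B, exists2 L, 0 <= L & lip_box b1 b2 B L) ->
  noise_bound M n1 n2 -> 0 < X -> 0 < kap <= 1 -> X < x0 -> 4 <= x0 ->
  (forall m k, (k <= m.+1)%N -> let y := grid m k in
    [/\ (0 < tau y)%E, u y 0 = x0, v y 0 = kap * x0 * y,
      forall t, 0 <= t -> (t%:E < tau y)%E ->
        noisy_path b1 b2 n1 n2 t (u y) (v y) &
      (tau y <= 1%:E)%E -> forall rho, exists t,
        [/\ 0 <= t, (t%:E < tau y)%E & rho < `|u y t| + `|v y t|]]) ->
  forall S, exists m k t,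
    let y := grid m k in
    [/\ (k <= m.+1)%N, 0 <= t <= 1, (t%:E < tau y)%E & S < u y t].
Proof.
move=> hb hup hdown hL hn X0 hk Xx0 x04 fam S.
apply: contrapT => noS.
have [k0 k1] := andP hk.
have uS m k t : (k <= m.+1)%N -> 0 <= t <= 1 -> (t%:E < tau (grid m k))%E ->
    u (grid m k) t <= S.
  move=> km t01 ttau; rewrite leNgt; apply/negP => Su; apply: noS.
  by exists m, k, t; split.
have [L L0 hLip] := hL (S + M).
have exit_at m k : (k <= m.+1)%N -> exists t,
    exits (tau (grid m k)) kap (u (grid m k)) (v (grid m k)) 1 t \/
    exits (tau (grid m k)) kap (u (grid m k)) (v (grid m k)) (-1) t.
  move=> km; have [tau0 u0 v0 path blow] := fam m k km.
  have v0u0 : `|v (grid m k) 0| <= kap * u (grid m k) 0.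
    have kx : 0 <= kap * x0 by rewrite mulr_ge0 //; lra.
    by rewrite u0 v0 normrM (ger0_norm kx) ler_piMr // grid_bound.
  apply: (exists_exit hb hn X0 hk _ _ v0u0 tau0 path blow); rewrite ?u0 //.
  by move=> t t01 ttau; exact: uS ttau.
(* [m] is chosen so that neighbouring starting points, at distance
   [d = 2 * kap * x0 / m.+1], stay close enough up to time [1]. *)
pose C := 64 * expR (4 * L) * x0 ^+ 2 / X ^+ 2.
have C0 : 0 <= C by rewrite divr_ge0 ?sqr_ge0 // mulr_ge0 ?sqr_ge0 // mulr_ge0 ?expR_ge0.
pose m := Num.truncn C.
have Cm : C <= m.+1%:R ^+ 2.
  have := truncnS_gt C; rewrite -/m => h.
  rewrite (le_trans (ltW h)) // expr2 ler_peMr // ler1n //.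
pose d := kap * x0 * (2 / m.+1%:R).
have m0 : 0 < m.+1%:R :> R by rewrite ltr0n.
have hd : 16 * (expR (4 * L) * d ^+ 2) <= (kap * X) ^+ 2.
  have -> : 16 * (expR (4 * L) * d ^+ 2) = kap ^+ 2 * X ^+ 2 * (C / m.+1%:R ^+ 2).
    by rewrite /d /C; field; rewrite gt_eqF //= gt_eqF.
  rewrite exprMn; apply: ler_piMr; first by rewrite mulr_ge0 ?sqr_ge0.
  by rewrite ler_pdivrMr ?mul1r // exprn_gt0.
have apart k k' s t : (k <= m.+1)%N -> (k' <= m.+1)%N ->
    kap * x0 * `|grid m k - grid m k'| <= d ->
    exits (tau (grid m k)) kap (u (grid m k)) (v (grid m k)) 1 s ->
    exits (tau (grid m k')) kap (u (grid m k')) (v (grid m k')) (-1) t -> False.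
  move=> km km' kk' e1 e2.
  have [_ u0 v0 path _] := fam m k km.
  have [_ u0' v0' path' _] := fam m k' km'.
  apply: (opposite_exits_apart hb hup hdown hn hLip X0 hk L0 path path' _ _ _ _ _ hd e1 e2).
  - by rewrite u0.
  - by rewrite u0 u0'.
  - by move=> r; exact: uS.
  - by move=> r; exact: uS.
  have kx : 0 <= kap * x0 by rewrite mulr_ge0 //; lra.
  by rewrite v0 v0' -mulrBr normrM (ger0_norm kx).
have down k : (k <= m.+1)%N -> exists t,
    exits (tau (grid m k)) kap (u (grid m k)) (v (grid m k)) (-1) t.
  elim: k => [_|k IH km].
    have [tau0 u0 v0 _ _] := fam m 0%N isT.
    have v0E : v (grid m 0) 0 = -1 * (kap * u (grid m 0) 0).
      by rewrite v0 u0 /grid mulr0 mul0r addr0 mulrC.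
    have kx : 0 <= kap * x0 by rewrite mulr_ge0 //; lra.
    exists 0; split; rewrite ?lexx ?ler01 // => r; rewrite -eq_le => /eqP <-.
    by rewrite v0E u0 mulN1r normrN ger0_norm.
  have [s e2] := IH (ltnW km).
  have [t [e1|]] := exit_at _ _ km; last by exists t.
  exfalso; apply: (apart _ _ _ _ km (ltnW km) _ e1 e2).
  have -> : grid m k.+1 - grid m k = 2 / m.+1%:R.
    by rewrite /grid -natr1; ring.
  by rewrite ger0_norm.
have [t e2] := down m.+1 (leqnn _).
have [tau0 u0 v0 _ _] := fam m m.+1 (leqnn _).
have kx : 0 <= kap * x0 by rewrite mulr_ge0 //; lra.
apply: (apart m.+1 m.+1 0 t _ _ _ _ e2) => //.
  by rewrite subrr normr0 mulr0 mulr_ge0.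
have v0E : v (grid m m.+1) 0 = kap * u (grid m m.+1) 0.
  by rewrite v0 u0 /grid mulfK ?gt_eqF //; ring.
split; rewrite ?lexx ?ler01 ?mul1r // => r; rewrite -eq_le => /eqP <-.
by rewrite v0E u0 ger0_norm.
Qed.

End ConeEscape.

(** * Expansion of the drift near the real axis *)

Section DriftExpansion.
Context {R : realType}.
Implicit Types (z w : R[i]) (x y h k M : R).
Local Notation normc := (@ComplexField.Normc.normc R).

Lemma normc_ge0 z : 0 <= normc z.
Proof. by case: z => a b; exact: sqrtr_ge0. Qed.

Lemma Re_le_normc z : `|complex.Re z| <= normc z.
Proof.
by case: z => a b /=; rewrite -sqrtr_sqr ler_wsqrtr // lerDl sqr_ge0.
Qed.

Lemma Im_le_normc z : `|complex.Im z| <= normc z.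
Proof.
by case: z => a b /=; rewrite -sqrtr_sqr ler_wsqrtr // lerDr sqr_ge0.
Qed.

Lemma ReD z w : complex.Re (z + w) = complex.Re z + complex.Re w.
Proof. by case: z w => a b [c d]. Qed.

Lemma ImD z w : complex.Im (z + w) = complex.Im z + complex.Im w.
Proof. by case: z w => a b [c d]. Qed.

Lemma normc_real x : normc (x%:C)%C = `|x|.
Proof. by rewrite /= expr0n addr0 sqrtr_sqr. Qed.

Lemma normc_i : normc 'i%C = 1.
Proof. by rewrite /= expr0n add0r expr1n sqrtr1. Qed.

Lemma ComplexE x y : Complex x y = (x%:C + 'i * y%:C)%C.
Proof. by rewrite [LHS]complexE. Qed.

Lemma normc_le x y : normc (Complex x y) <= `|x| + `|y|.
Proof.
rewrite ComplexE (le_trans (le_normcD _ _)) // normc_real ComplexField.Normc.normcM normc_i mul1r.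
by rewrite normc_real.
Qed.

Lemma normcX z m : normc (z ^+ m) = normc z ^+ m.
Proof.
elim: m => [|m IH]; first by rewrite !expr0 ComplexField.Normc.normc1.
by rewrite !exprS ComplexField.Normc.normcM IH.
Qed.

Lemma normc_exprB z w rho m : normc z <= rho -> normc w <= rho ->
  normc (z ^+ m.+1 - w ^+ m.+1) <= m.+1%:R * rho ^+ m * normc (z - w).
Proof.
move=> zr wr; elim: m => [|m IH]; first by rewrite !expr1 expr0 !mul1r.
have r0 : 0 <= rho := le_trans (normc_ge0 z) zr.
have -> : z ^+ m.+2 - w ^+ m.+2 =
    z * (z ^+ m.+1 - w ^+ m.+1) + (z - w) * w ^+ m.+1 by rewrite !exprS; ring.
rewrite (le_trans (le_normcD _ _)) // !ComplexField.Normc.normcM.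
have h1 : normc z * normc (z ^+ m.+1 - w ^+ m.+1) <=
    rho * (m.+1%:R * rho ^+ m * normc (z - w)).
  by rewrite ler_pM // normc_ge0.
have h2 : normc (z - w) * normc (w ^+ m.+1) <= normc (z - w) * rho ^+ m.+1.
  rewrite ler_wpM2l ?normc_ge0 // normcX.
  by rewrite lerXn2r // nnegrE ?normc_ge0.
rewrite (le_trans (lerD h1 h2)) // -[m.+2%:R]natr1 exprS.
by rewrite le_eqVlt; apply/orP; left; apply/eqP; ring.
Qed.

(** All terms of the binomial expansion after the first two contain the factor
    [y ^+ 2], and [|y| <= x] turns the further powers of [y] into powers of
    [x]. *)
Lemma expr_near_real_axis m : exists2 D : R, 0 <= D &
  forall x y, `|y| <= x ->
    normc (Complex x y ^+ m.+2 -
           Complex (x ^+ m.+2) (m.+2%:R * (y * x ^+ m.+1)))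
      <= D * (y ^+ 2 * x ^+ m).
Proof.
elim: m => [|m [D D0 IH]].
  exists 1 => // x y yx.
  have -> : Complex x y ^+ 2 - Complex (x ^+ 2) (2 * (y * x ^+ 1)) = ((- y ^+ 2)%:C)%C.
    by rewrite !expr2 expr1; apply/eqP; rewrite eq_complex /=; apply/andP; split; apply/eqP; ring.
  by rewrite normc_real expr0 mulr1 mul1r normrN ger0_norm ?sqr_ge0.
exists (m.+2%:R + 2 * D); first by rewrite addr_ge0 // mulr_ge0.
move=> x y yx; have x0 : 0 <= x := le_trans (normr_ge0 y) yx.
have hE := IH x y yx.
set E1 := Complex x y ^+ m.+2 - _ in hE.
have -> : Complex x y ^+ m.+3 - Complex (x ^+ m.+3) (m.+3%:R * (y * x ^+ m.+2)) =
    Complex x y * E1 + ((- (m.+2%:R * (y ^+ 2 * x ^+ m.+1)))%:C)%C.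
  rewrite /E1 mulrBr -exprS -addrA; congr (_ + _).
  apply/eqP; rewrite eq_complex /= -[m.+3%:R]natr1 !exprS.
  by apply/andP; split; apply/eqP; ring.
rewrite (le_trans (le_normcD _ _)) // ComplexField.Normc.normcM normc_real normrN.
have c0 : 0 <= m.+2%:R * (y ^+ 2 * x ^+ m.+1) :> R.
  by rewrite mulr_ge0 // mulr_ge0 ?sqr_ge0 // exprn_ge0.
rewrite (ger0_norm c0).
have zx : normc (Complex x y) <= 2 * x.
  by rewrite (le_trans (normc_le _ _)) // (ger0_norm x0); lra.
have h : normc (Complex x y) * normc E1 <= 2 * x * (D * (y ^+ 2 * x ^+ m)).
  by rewrite ler_pM // normc_ge0.
rewrite (le_trans (lerD h (lexx _))) // [x ^+ m.+1]exprS.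
by rewrite le_eqVlt; apply/orP; left; apply/eqP; ring.
Qed.

Variables (m : nat) (F : R[i] -> R[i]).
Hypothesis hFO : bigO_powC F m.+1.
Let b1 x y := (poly_drift m.+2 F (x, y)).1.
Let b2 x y := (poly_drift m.+2 F (x, y)).2.

(** The noise changes [z ^+ m.+2] by a term of order [|z| ^+ m.+1], which is
    also the order of [F]. *)
Lemma perturbation_small M : 0 <= M -> exists C X : R, [/\ 0 <= C, 1 <= X &
  forall x y h k, X <= x -> `|y| <= x -> `|h| <= M -> `|k| <= M ->
    normc (Complex (x + h) (y + k) ^+ m.+2 + F (Complex (x + h) (y + k)) -
           Complex x y ^+ m.+2) <= C * x ^+ m.+1].
Proof.
move=> M0; have [A [K hA]] := hFO.
exists (m.+2%:R * 4 ^+ m.+1 * (2 * M) + `|A| * 4 ^+ m.+1), (1 + M + `|K|).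
split.
- by rewrite addr_ge0 ?mulr_ge0 ?exprn_ge0.
- by rewrite -addrA lerDl addr_ge0.
move=> x y h k Xx yx hM kM.
have K0 := normr_ge0 K; have KK := ler_norm K.
have x0 : 0 <= x by lra.
have r0 : 0 <= 4 * x by rewrite mulr_ge0.
have z4 : normc (Complex x y) <= 4 * x.
  by rewrite (le_trans (normc_le _ _)) // (ger0_norm x0); lra.
have zw4 : normc (Complex (x + h) (y + k)) <= 4 * x.
  rewrite (le_trans (normc_le _ _)) //.
  have := ler_normD x h; have := ler_normD y k; rewrite (ger0_norm x0).
  by lra.
have zwK : K <= normc (Complex (x + h) (y + k)).
  apply: le_trans (Re_le_normc _) => /=; apply: le_trans (ler_norm _).
  by move: hM; rewrite ler_norml => /andP[]; lra.
rewrite addrAC (le_trans (le_normcD _ _)) // mulrDl lerD //.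
  rewrite (le_trans (normc_exprB _ zw4 z4)) // exprMn.
  rewrite [leRHS](_ : _ = m.+2%:R * (4 ^+ m.+1 * x ^+ m.+1) * (2 * M)); last by ring.
  rewrite ler_wpM2l ?mulr_ge0 ?exprn_ge0 //.
  have -> : Complex (x + h) (y + k) - Complex x y = Complex h k.
    by apply/eqP; rewrite eq_complex /= ![_ + _ - _]addrAC !subrr !add0r !eqxx.
  by rewrite (le_trans (normc_le _ _)) //; lra.
rewrite (le_trans (hA _ zwK)) // -mulrA -exprMn.
rewrite (@le_trans _ _ (`|A| * normc (Complex (x + h) (y + k)) ^+ m.+1)) //.
  by rewrite ler_wpM2r ?ler_norm // exprn_ge0 // normc_ge0.
by rewrite ler_wpM2l // lerXn2r // nnegrE ?normc_ge0.
Qed.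

Lemma drift_expansion : exists2 D : R, 0 <= D & forall M, 0 <= M ->
  exists C X : R, [/\ 0 <= C, 1 <= X &
  forall x y h k, X <= x -> `|y| <= x -> `|h| <= M -> `|k| <= M ->
    `|b1 (x + h) (y + k) - x ^+ m.+2| <= D * (y ^+ 2 * x ^+ m) + C * x ^+ m.+1 /\
    `|b2 (x + h) (y + k) - m.+2%:R * (y * x ^+ m.+1)|
      <= D * (y ^+ 2 * x ^+ m) + C * x ^+ m.+1].
Proof.
have [D D0 hD] := expr_near_real_axis m.
exists D => // M M0; have [C [X [C0 X1 hC]]] := perturbation_small M0.
exists C, X; split => // x y h k Xx yx hM kM.
have := lerD (hD x y yx) (hC x y h k Xx yx hM kM).
move=> /(le_trans (le_normcD _ _)).
set G := _ + F _.
rewrite addrC addrA subrK => H.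
split.
  apply: le_trans H; apply: le_trans (Re_le_normc _).
  by rewrite /b1 /poly_drift /toC /G !ReD /=.
apply: le_trans H; apply: le_trans (Im_le_normc _).
by rewrite /b2 /poly_drift /toC /G !ImD /=.
Qed.

(** Along a ray of slope [th] the drift [z ^+ m.+2] is, to first order in [th],
    [x ^+ m.+2] times [(1, m.+2 * th)]. Its first entry dominates in the cone,
    and on slopes [th >= 3 / 8 * kap] its own slope [m.+2 * th >= 3 / 4 * kap]
    exceeds [kap / 2]. *)
Lemma cone_drift : exists2 kap0 : R, 0 < kap0 <= 1 &
  forall kap, 0 < kap <= kap0 -> forall M, 0 <= M -> exists2 X : R, 0 < X &
    [/\ pushes_right b1 kap X M, pushes_up b1 b2 kap X M &
        pushes_up (fun x y => b1 x (- y)) (fun x y => - b2 x (- y)) kap X M].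
Proof.
have [D D0 hD] := drift_expansion.
exists (16 * (D + 1))^-1.
  by rewrite invr_gt0 mulr_gt0 ?invf_le1 //= ?mulr_gt0; lra.
move=> kap /andP[k0 kD] M M0.
have [C [X [C0 X1 hC]]] := hD M M0.
have kD' : D * kap <= 16^-1 .
  have D1 : 0 < D + 1 by lra.
  by move: kD; rewrite -[leRHS]div1r ler_pdivlMr ?mulr_gt0 //; lra.
have k1 : kap <= 1.
  apply: le_trans kD _; rewrite invf_le1 ?mulr_gt0 //; lra.
(* beyond [64 * C / kap] the error [C * x ^+ m.+1] is at most
   [kap / 64 * x ^+ m.+2] *)
exists (X + 64 * C / kap).
  by rewrite ltr_wpDr // ?mulr_ge0 ?invr_ge0 //; lra.
have CK : 0 <= 64 * C / kap by rewrite divr_ge0 ?mulr_ge0 // ltW.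
have err x y : X + 64 * C / kap <= x -> `|y| <= kap * x ->
    D * (y ^+ 2 * x ^+ m) + C * x ^+ m.+1 <= kap / 8 * x ^+ m.+2.
  move=> Xx yx.
  have x0 : 0 <= x by lra.
  have y2 : y ^+ 2 <= kap ^+ 2 * x ^+ 2.
    rewrite -exprMn -(real_normK (num_real y)) lerXn2r // nnegrE.
    by rewrite (le_trans _ yx).
  have q0 : 0 <= x ^+ m by rewrite exprn_ge0.
  have h1 : D * (y ^+ 2 * x ^+ m) <= kap / 16 * x ^+ m.+2.
    rewrite (@le_trans _ _ (D * (kap ^+ 2 * x ^+ 2 * x ^+ m))) //.
      by rewrite ler_wpM2l // ler_wpM2r.
    have -> : D * (kap ^+ 2 * x ^+ 2 * x ^+ m) = kap * (D * kap) * x ^+ m.+2.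
      by rewrite !exprS; ring.
    by rewrite ler_wpM2r ?exprn_ge0 // ler_wpM2l // ltW.
  have h2 : C * x ^+ m.+1 <= kap / 64 * x ^+ m.+2.
    rewrite [x ^+ m.+2]exprS mulrA ler_wpM2r ?exprn_ge0 //.
    have : 64 * C / kap <= x by lra.
    by rewrite ler_pdivrMr // [x * _]mulrC; lra.
  have : 0 <= kap * x ^+ m.+2 by rewrite mulr_ge0 ?exprn_ge0 // ltW.
  by lra.
have k0' := ltW k0.
have main x y h k : X + 64 * C / kap <= x -> `|y| <= kap * x ->
    `|h| <= M -> `|k| <= M ->
    `|b1 (x + h) (y + k) - x ^+ m.+2| <= kap / 8 * x ^+ m.+2 /\
    `|b2 (x + h) (y + k) - m.+2%:R * (y * x ^+ m.+1)| <= kap / 8 * x ^+ m.+2.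
  move=> Xx yx hM kM; have x0 : 0 <= x by lra.
  have yx1 : `|y| <= x by rewrite (le_trans yx) // ler_piMl.
  have [|e1 e2] := hC x y h k _ yx1 hM kM; first by lra.
  by split; apply: le_trans (err x y Xx yx).
have up x y (c1 c2 : R) : X <= x -> 3 / 8 * kap * x <= y ->
    `|c1 - x ^+ m.+2| <= kap / 8 * x ^+ m.+2 ->
    `|c2 - m.+2%:R * (y * x ^+ m.+1)| <= kap / 8 * x ^+ m.+2 ->
    kap / 2 * c1 <= c2.
  move=> Xx yx; rewrite !ler_norml => /andP[_ e1] /andP[e2 _].
  have x0 : 0 <= x by lra.
  have P0 : 0 <= x ^+ m.+1 by rewrite exprn_ge0.
  have Q0 : 0 <= x ^+ m.+2 by rewrite exprn_ge0.
  have yP : 3 / 8 * kap * x ^+ m.+2 <= y * x ^+ m.+1.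
    by rewrite [x ^+ m.+2]exprS mulrA ler_wpM2r.
  have kQ : 0 <= kap * x ^+ m.+2 by rewrite mulr_ge0.
  have yP0 : 0 <= y * x ^+ m.+1 by lra.
  have yP2 : 2 * (y * x ^+ m.+1) <= m.+2%:R * (y * x ^+ m.+1).
    by rewrite ler_wpM2r // ler_nat.
  have h1 : kap / 2 * c1 <= kap / 2 * (x ^+ m.+2 + kap / 8 * x ^+ m.+2).
    by rewrite ler_wpM2l ?divr_ge0 //; lra.
  have h2 : kap * (kap * x ^+ m.+2) <= kap * x ^+ m.+2 by rewrite ler_piMl.
  by lra.
split.
- move=> x y h k Xx yx hM kM.
  have [e1 _] := main x y h k Xx yx hM kM.
  have x1 : 1 <= x by lra.
  have xm : x ^+ 2 <= x ^+ m.+2 by rewrite ler_weXn2l.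
  have : kap * x ^+ m.+2 <= x ^+ m.+2 by rewrite ler_piMl // exprn_ge0 //; lra.
  have := sqr_ge0 x.
  by move: e1; rewrite ler_norml => /andP[]; lra.
- move=> x y h k Xx /andP[y1 y2] hM kM; have x0 : 0 <= x by lra.
  have kx : 0 <= kap * x by rewrite mulr_ge0.
  have yx : `|y| <= kap * x by rewrite ler_norml; lra.
  have [e1 e2] := main x y h k Xx yx hM kM.
  by apply: up e1 e2; lra.
- move=> x y h k Xx /andP[y1 y2] hM kM; have x0 : 0 <= x by lra.
  have kx : 0 <= kap * x by rewrite mulr_ge0.
  have yx : `|- y| <= kap * x by rewrite normrN ler_norml; lra.
  have kM' : `|- k| <= M by rewrite normrN.
  have [e1 e2] := main x (- y) h (- k) Xx yx hM kM'.
  rewrite opprD; apply: (up x y) => //; first by lra.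
  by rewrite -normrN opprB opprK addrC; move: e2; rewrite mulNr mulrN opprK.
Qed.

End DriftExpansion.

(** * Lipschitz constants of the drift on boxes *)

Section DriftLipschitz.
Context {R : realType}.
Implicit Types (G F : R[i] -> R[i]) (z w : R[i]) (p q : R * R) (B L : R).
Local Notation normc := (@ComplexField.Normc.normc R).

Lemma locally_lipschitzC_drift m F : locally_lipschitzC F ->
  locally_lipschitzC (fun z => z ^+ m.+1 + F z).
Proof.
move=> hF z; have [r [L [r0 hL]]] := hF z.
exists (Num.min 1 r), (m.+1%:R * (normc z + 1) ^+ m + L).
split=> [|u v]; first by rewrite lt_min ltr01.
rewrite !lt_min => /andP[u1 ur] /andP[v1 vr].
have -> : u ^+ m.+1 + F u - (v ^+ m.+1 + F v) = (u ^+ m.+1 - v ^+ m.+1) + (F u - F v).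
  by ring.
have near1 w : normc (w - z) < 1 -> normc w <= normc z + 1.
  move=> w1; have -> : w = z + (w - z) by ring.
  by rewrite (le_trans (le_normcD _ _)) // lerD2l ltW.
rewrite (le_trans (le_normcD _ _)) // mulrDl lerD //; last exact: hL.
by apply: normc_exprB; exact: near1.
Qed.

Definition dist1 p q := `|p.1 - q.1| + `|p.2 - q.2|.

Lemma normc_toC_le p q : normc (toC p - toC q) <= dist1 p q.
Proof. exact: (normc_le (p.1 - q.1) (p.2 - q.2)). Qed.

(** The set of pairs [(p, q)] of points of the box is compact, and near each of
    them some constant works: the local one on the diagonal, and off the
    diagonal the ratio of a bound of the numerator to the distance. *)
Lemma lipschitz_on_box G B : locally_lipschitzC G ->
  exists2 L, 0 <= L & forall p q,
    `|p.1| <= B -> `|p.2| <= B -> `|q.1| <= B -> `|q.2| <= B ->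
    normc (G (toC p) - G (toC q)) <= L * dist1 p q.
Proof.
move=> hG.
pose I : set R := [set` `[- B, B]%R].
pose K := (I `*` I) `*` (I `*` I).
have cI : compact I := @segment_compact _ _ _.
have cK : compact K by do 2 apply: compact_setX => //.
have /compact_near_coveringP ncK := cK.
have local p : exists r L, [/\ 0 < r, 0 <= L & forall p' q', ball p r p' -> ball p r q' ->
    normc (G (toC p') - G (toC q')) <= L * dist1 p' q'].
  have [r [L [r0 hL]]] := hG (toC p).
  exists (r / 2), `|L|; split => // [|p' q' [p1 p2] [q1 q2]]; first by rewrite divr_gt0.
  have inr p0 : ball p (r / 2) p0 -> normc (toC p0 - toC p) < r.
    move=> [d1 d2]; rewrite (le_lt_trans (normc_toC_le _ _)) // /dist1.
    move: d1 d2; rewrite /ball /= distrC => d1; rewrite distrC => d2.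
    by rewrite [ltRHS]splitr ltrD.
  apply: (le_trans (hL _ _ (inr p' _) (inr q' _))) => //.
  apply: (@le_trans _ _ (`|L| * normc (toC p' - toC q'))).
    by rewrite ler_wpM2r ?normc_ge0 // ler_norm.
  by rewrite ler_wpM2l // normc_toC_le.
have near_each_pair pq : K pq -> \forall pq' \near pq & L \near +oo,
    normc (G (toC pq'.1) - G (toC pq'.2)) <= L * dist1 pq'.1 pq'.2.
  case: pq => p q _.
  have [r [L [r0 L0 hL]]] := local p.
  have dist_ge0 p0 q0 : 0 <= dist1 p0 q0 by rewrite addr_ge0.
  have [<-|pq] := eqVneq p q.
    exists (ball (p, p) r, [set L' | L < L']).
      by split; [exact: nbhsx_ballx|exact: nbhs_pinfty_gt (num_real _)].
    move=> [[p' q'] L'] [[/= bp bq] LL'].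
    by rewrite (le_trans (hL p' q' bp bq)) // ler_wpM2r // ltW.
  have [s [M [s0 M0 hM]]] := local q.
  have e0 : 0 < dist1 p q.
    rewrite lt_neqAle dist_ge0 andbT eq_sym.
    apply: contra pq; rewrite paddr_eq0 // !normr_eq0 !subr_eq0.
    by case: p q {local hL hM} => p1 p2 [q1 q2] /= /andP[/eqP-> /eqP->].
  set e := dist1 p q in e0.
  pose t := Num.min (Num.min r s) (e / 8).
  have t0 : 0 < t by rewrite !lt_min r0 s0 divr_gt0.
  pose C := L * (2 * t) + M * (2 * t) + normc (G (toC p) - G (toC q)).
  have t2 : 0 <= 2 * t by rewrite mulr_ge0 // ltW.
  have C0 : 0 <= C by rewrite addr_ge0 ?normc_ge0 // addr_ge0 // mulr_ge0.
  exists (ball (p, q) t, [set L' | C / (e / 2) < L']).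
    by split; [exact: nbhsx_ballx|exact: nbhs_pinfty_gt (num_real _)].
  move=> [[p' q'] L'] [[/= bp bq] LL'].
  have d2 p0 p1 : ball p0 t p1 -> dist1 p1 p0 <= 2 * t.
    case=> b1 b2; move: b1 b2; rewrite /ball /= /dist1 distrC => b1.
    by rewrite distrC => b2; lra.
  have tr : t <= r by rewrite !ge_min lexx.
  have ts : t <= s by rewrite !ge_min lexx orbT.
  have te : t <= e / 8 by rewrite !ge_min lexx orbT.
  have hp := hL p' p (le_ball tr bp) (ballxx _ r0).
  have hq := hM q' q (le_ball ts bq) (ballxx _ s0).
  have dp := d2 _ _ bp; have dq := d2 _ _ bq.
  have num : normc (G (toC p') - G (toC q')) <= C.
    have -> : G (toC p') - G (toC q') = (G (toC p') - G (toC p)) +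
      (- (G (toC q') - G (toC q)) + (G (toC p) - G (toC q))) by ring.
    rewrite (le_trans (le_normcD _ _)) // /C -addrA lerD //.
      by rewrite (le_trans hp) // ler_wpM2l.
    rewrite (le_trans (le_normcD _ _)) // lerD // normcN.
    by rewrite (le_trans hq) // ler_wpM2l.
  have den : e / 2 <= dist1 p' q'.
    have tri1 := ler_distD p'.1 p.1 q.1; have tri2 := ler_distD q'.1 p'.1 q.1.
    have tri3 := ler_distD p'.2 p.2 q.2; have tri4 := ler_distD q'.2 p'.2 q.2.
    move: dp dq te; rewrite /e /dist1 (distrC p'.1 p.1) (distrC p'.2 p.2).
    by lra.
  rewrite (le_trans num) // (@le_trans _ _ (L' * (e / 2))) //.
    by rewrite -ler_pdivrMr ?divr_gt0 // ltW.
  by rewrite ler_wpM2l // (le_trans _ (ltW LL')) // divr_ge0 // divr_ge0 // ltW.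
have [L0 [_ hL0]] := ncK R (pinfty_nbhs R) (fun L pq =>
  normc (G (toC pq.1) - G (toC pq.2)) <= L * dist1 pq.1 pq.2) _ near_each_pair.
exists (`|L0| + 1); first by rewrite addr_ge0.
move=> p q p1 p2 q1 q2; apply: (hL0 (`|L0| + 1) _ (p, q)).
  by rewrite (le_lt_trans (ler_norm _)) // ltrDl.
by rewrite /K /I /= !in_itv /= -!ler_norml.
Qed.

Lemma drift_lip_box n F B : (0 < n)%N -> locally_lipschitzC F ->
  exists2 L, 0 <= L & lip_box (fun x y => (poly_drift n F (x, y)).1)
    (fun x y => (poly_drift n F (x, y)).2) B L.
Proof.
case: n => // n _ /(locally_lipschitzC_drift n) hG.
have [L L0 hL] := lipschitz_on_box B hG.
exists L => // x y x' y' xB yB x'B y'B.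
have h := hL (x, y) (x', y') xB yB x'B y'B.
split; apply: le_trans h; [apply: le_trans (Re_le_normc _)|apply: le_trans (Im_le_normc _)].
  by rewrite /poly_drift /= -!ReD; case: (_ + F _) => a b; case: (_ + F _).
by rewrite /poly_drift /= -!ImD; case: (_ + F _) => a b; case: (_ + F _).
Qed.

End DriftLipschitz.

(** * From the integral equation to unbounded paths *)

Section SolutionPaths.
Context {R : realType}.
Implicit Types (f w : R -> R) (x t : R).

(** This is the fundamental theorem of calculus; the end points are left out as
    [f] is only continuous from one side there. *)
Lemma integral_diff_on f w x t : 0 <= t -> {within `[0, t], continuous f} ->
  (forall s, 0 <= s <= t -> w s = x + \int[lebesgue_measure]_(r in `[0, s]) f r) ->
  diff_on 0 t w f.
Proof.
move=> t0 cf wE.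
have intf : lebesgue_measure.-integrable `[0, t] (EFin \o f).
  by apply: continuous_compact_integrable => //; exact: segment_compact.
split.
  have cI := parameterized_integral_continuous t0 intf.
  apply: (@subspace_eq_continuous _ _ _ (fun s => x +
    parameterized_integral lebesgue_measure 0 s f)).
    by move=> s; rewrite inE /= in_itv /= => s0t; exact/esym/wE.
  move=> s; apply: (@continuousD _ _ (subspace `[0, t]) (fun=> x)); last exact: cI.
  exact: cvg_cst.
move=> r r0t; have /andP[r0 rt] := r0t.
have rI : r \in `]0, t[%R by rewrite in_itv.
have cfr : {for r, continuous f}.
  have t_gt0 := lt_trans r0 rt.
  by have [+ _ _] := (continuous_within_itvP f t_gt0).1 cf; apply.
have [dF F'] := continuous_FTC1_closed rt intf r0 cfr.
have dI : is_derive r 1 (fun s : R => \int[lebesgue_measure]_(q in `[0, s]) f q) (f r).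
  by apply: DeriveDef => //; rewrite -derive1E.
have dxI : is_derive r 1
    (fun s : R => x + \int[lebesgue_measure]_(q in `[0, s]) f q) (f r).
  by have := is_deriveD (is_derive_cst x r 1) dI; rewrite add0r.
apply: near_eq_is_derive dxI.
near=> s; rewrite wE //.
have : s \in `]0, t[%R by near: s; exact: near_in_itvoo.
by rewrite in_itv /= => /andP[/ltW-> /ltW->].
Unshelve. all: by end_near. Qed.

Lemma lip_box_continuous (b1 b2 : R -> R -> R) :
  (forall B, exists2 L, 0 <= L & lip_box b1 b2 B L) ->
  continuous (fun p : R * R => b1 p.1 p.2) /\
  continuous (fun p : R * R => b2 p.1 p.2).
Proof.
move=> hL.
have H (p : R * R) eps : 0 < eps -> \forall q \near p,
    `|b1 p.1 p.2 - b1 q.1 q.2| < eps /\ `|b2 p.1 p.2 - b2 q.1 q.2| < eps.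
  move=> e0; have [L L0 hLip] := hL (`|p.1| + `|p.2| + 1).
  pose r := Num.min 1 (eps / (2 * L + 1) / 2).
  have L1 : 0 < 2 * L + 1 by lra.
  have r0 : 0 < r by rewrite lt_min ltr01 !divr_gt0.
  exists (ball p.1 r, ball p.2 r); first by split; exact: nbhsx_ballx.
  move=> [q1 q2] [/= d1 d2].
  have r1 : r <= 1 by rewrite ge_min lexx.
  have re : L * (r + r) < eps.
    have : r <= eps / (2 * L + 1) / 2 by rewrite ge_min lexx orbT.
    rewrite ler_pdivlMr // ler_pdivlMr // => h.
    by lra.
  have dq1 : `|p.1 - q1| < r by [].
  have dq2 : `|p.2 - q2| < r by [].
  have n1 := ler_normB p.1 (p.1 - q1); have n2 := ler_normB p.2 (p.2 - q2).
  have p1 := normr_ge0 p.1; have p2 := normr_ge0 p.2.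
  rewrite !subKr in n1 n2.
  have := hLip p.1 p.2 q1 q2.
  have -> : `|p.1| <= `|p.1| + `|p.2| + 1 by lra.
  have -> : `|p.2| <= `|p.1| + `|p.2| + 1 by lra.
  have -> : `|q1| <= `|p.1| + `|p.2| + 1 by lra.
  have -> : `|q2| <= `|p.1| + `|p.2| + 1 by lra.
  move=> /(_ isT isT isT isT)[h1 h2].
  have Lr : L * (`|p.1 - q1| + `|p.2 - q2|) <= L * (r + r).
    by rewrite ler_wpM2l // lerD // ltW.
  by split; [apply: le_lt_trans h1 _|apply: le_lt_trans h2 _]; apply: le_lt_trans Lr re.
by split=> p; apply/cvgrPdist_lt => eps e0;
  apply: filterS (H p eps e0) => q [].
Qed.

Lemma solution_noisy_path (drift : R * R -> R * R) (b1 b2 : R -> R -> R)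
    (X : R -> R * R) (tau : \bar R) (n1 n2 : R -> R) (x : R * R) t :
  (forall p, drift p = (b1 p.1 p.2, b2 p.1 p.2)) ->
  (forall B, exists2 L, 0 <= L & lip_box b1 b2 B L) ->
  {within [set t : R | 0 <= t /\ (t%:E < tau)%E], continuous X} ->
  (forall t, 0 <= t -> (t%:E < tau)%E ->
    (X t).1 = x.1 + \int[lebesgue_measure]_(r in `[0, t]) (drift (X r)).1 + n1 t /\
    (X t).2 = x.2 + \int[lebesgue_measure]_(r in `[0, t]) (drift (X r)).2 + n2 t) ->
  0 <= t -> (t%:E < tau)%E ->
  noisy_path b1 b2 n1 n2 t (fun r => (X r).1 - n1 r) (fun r => (X r).2 - n2 r).
Proof.
move=> dE hL cX XE t0 ttau.
have [c1 c2] := lip_box_continuous hL.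
have cXt : {within `[0, t], continuous X}.
  apply: continuous_subspaceW cX => r /=; rewrite in_itv /= => /andP[r0 rt].
  by split=> //; rewrite (le_lt_trans _ ttau) // lee_fin.
have lts s : 0 <= s <= t -> (s%:E < tau)%E.
  by move=> /andP[_ st]; rewrite (le_lt_trans _ ttau) // lee_fin.
have path (b : R -> R -> R) (pr : R * R -> R) (n : R -> R) :
    continuous (fun p : R * R => b p.1 p.2) ->
    (forall r, 0 <= r <= t -> pr (X r) = pr x +
      \int[lebesgue_measure]_(s in `[0, r]) b (X s).1 (X s).2 + n r) ->
    diff_on 0 t (fun r => pr (X r) - n r)
      (fun r => b ((X r).1 - n1 r + n1 r) ((X r).2 - n2 r + n2 r)).
  move=> cb XbE.
  have cf : {within `[0, t], continuous (fun r => b (X r).1 (X r).2)}.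
    move=> r; exact: (@continuous_comp (subspace `[0, t]) _ _ X
      (fun p : R * R => b p.1 p.2) r (cXt r) (cb (X r))).
  apply: (@diff_on_eq _ _ _ _ (fun r => b (X r).1 (X r).2)) => [|//|r _].
    by apply: (integral_diff_on t0 cf) => s /XbE ->; rewrite addrK.
  by rewrite !subrK.
split.
- apply: (path b1 fst n1 c1) => r r0t; have /andP[r0 _] := r0t.
  rewrite (XE r r0 (lts r r0t)).1; congr (_ + _ + _).
  by apply: eq_Rintegral => s _; rewrite dE.
- apply: (path b2 snd n2 c2) => r r0t; have /andP[r0 _] := r0t.
  rewrite (XE r r0 (lts r r0t)).2; congr (_ + _ + _).
  by apply: eq_Rintegral => s _; rewrite dE.
Qed.

End SolutionPaths.

Section Escape.
Context {R : realType}.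

(** Bounded noise cannot compensate an explosion. *)
Lemma explosion_unbounded (tau : \bar R) (X : R -> R * R) (n1 n2 : R -> R) (M : R) :
  (0 < tau)%E -> (tau <= 1%:E)%E -> noise_bound M n1 n2 ->
  ((tau < +oo)%E -> `|X t| @[t --> (fine tau)^'-] --> +oo) ->
  forall rho : R, exists t, [/\ 0 <= t, (t%:E < tau)%E &
    rho < `|(X t).1 - n1 t| + `|(X t).2 - n2 t|].
Proof.
case: tau => [s| |] //; rewrite lte_fin lee_fin => s0 s1 hn /(_ (ltry _)) /= Xoo rho.
near s^'- => t.
have Xt : rho + 2 * M < `|X t| by near: t; move/cvgryPgt : Xoo; apply.
have t0 : 0 < t by near: t; exact: nbhs_left_gt.
have ts : t < s by near: t; exact: nbhs_left_lt.
have [|h1 h2] := hn t; first by lra.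
exists t; split; rewrite ?lte_fin ?(ltW t0) //.
have : `|X t| <= `|(X t).1| + `|(X t).2|.
  by rewrite prod_normE ge_max lerDl lerDr !normr_ge0.
have := lerB_dist (X t).1 (n1 t); have := lerB_dist (X t).2 (n2 t).
by lra.
Unshelve. all: by end_near. Qed.

Lemma pathwise_escape n F (sigma kap X M x0 : R) (W1 W2 : R -> R)
    (phi : R -> R * R -> R * R) (e : R * R -> \bar R) :
  let b1 x y := (poly_drift n F (x, y)).1 in
  let b2 x y := (poly_drift n F (x, y)).2 in
  let n1 t := sigma * (W1 t - W1 0) in
  let n2 t := sigma * (W2 t - W2 0) in
  (0 < n)%N -> locally_lipschitzC F ->
  pushes_right b1 kap X M -> pushes_up b1 b2 kap X M ->
  pushes_up (fun x y => b1 x (- y)) (fun x y => - b2 x (- y)) kap X M ->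
  noise_bound M n1 n2 -> 0 < X -> 0 < kap <= 1 -> X < x0 -> 4 <= x0 ->
  (forall m k, (k <= m.+1)%N -> let z := (x0, kap * x0 * grid m k) in
    [/\ (0 < e z)%E,
      {within [set t : R | 0 <= t /\ (t%:E < e z)%E], continuous (phi^~ z)},
      (forall t, 0 <= t -> (t%:E < e z)%E ->
        (phi t z).1 = z.1 +
          \int[lebesgue_measure]_(r in `[0, t]) (poly_drift n F (phi r z)).1 + n1 t /\
        (phi t z).2 = z.2 +
          \int[lebesgue_measure]_(r in `[0, t]) (poly_drift n F (phi r z)).2 + n2 t) &
      ((e z < +oo)%E -> `|phi t z| @[t --> (fine (e z))^'-] --> +oo)]) ->
  forall S, exists m k t, let z := (x0, kap * x0 * grid m k) in
    [/\ (k <= m.+1)%N, 0 <= t <= 1, (t%:E < e z)%E & S < (phi t z).1].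
Proof.
move=> b1 b2 n1 n2 n0 hF hb hup hdown hn X0 hk Xx0 x04 fam S.
have hL B : exists2 L, 0 <= L & lip_box b1 b2 B L := drift_lip_box B n0 hF.
pose z y := (x0, kap * x0 * y).
have n10 : n1 0 = 0 by rewrite /n1 subrr mulr0.
have n20 : n2 0 = 0 by rewrite /n2 subrr mulr0.
have := some_path_unbounded (u := fun y r => (phi r (z y)).1 - n1 r)
  (v := fun y r => (phi r (z y)).2 - n2 r) (tau := fun y => e (z y))
  hb hup hdown hL hn X0 hk Xx0 x04.
have fam' : forall m k, (k <= m.+1)%N -> let y := grid m k in
    [/\ (0 < e (z y))%E, (phi 0 (z y)).1 - n1 0 = x0,
      (phi 0 (z y)).2 - n2 0 = kap * x0 * y,
      forall t, 0 <= t -> (t%:E < e (z y))%E ->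
        noisy_path b1 b2 n1 n2 t (fun r => (phi r (z y)).1 - n1 r)
          (fun r => (phi r (z y)).2 - n2 r) &
      (e (z y) <= 1%:E)%E -> forall rho, exists t,
        [/\ 0 <= t, (t%:E < e (z y))%E &
          rho < `|(phi t (z y)).1 - n1 t| + `|(phi t (z y)).2 - n2 t|]].
  move=> m k km y; have [e0 cphi eqn expl] := fam m k km.
  have [q1 q2] := eqn 0 (lexx _) e0.
  split => //.
  - by rewrite q1 addrK set_itv1 Rintegral_set1 addr0.
  - by rewrite q2 addrK set_itv1 Rintegral_set1 addr0.
  - move=> t t0 tz; apply: (solution_noisy_path _ hL cphi eqn t0 tz).
    by case=> p1 p2; rewrite /b1 /b2; case: poly_drift.
  - by move=> e1; exact: explosion_unbounded e0 e1 hn expl.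
move=> /(_ fam' (S + M))[m [k [t [km t01 tz SM]]]].
exists m, k, t; split => //.
by have [h _] := hn t t01; move: h SM; rewrite ler_norml => /andP[]; lra.
Qed.

End Escape.

(** * Reduction to rational times and points *)

Section RationalTimes.
Context {R : realType}.
Implicit Types lo hi t q : R.

(** Clipping is a contraction fixing the interval pointwise, so the clipped
    rationals are a countable dense subset which lies inside the interval. *)
Definition clip lo hi q := Num.min hi (Num.max lo q).

Lemma clip_itv lo hi q : lo <= hi -> lo <= clip lo hi q <= hi.
Proof. by move=> lh; rewrite /clip le_min lh le_max lexx ge_min lexx. Qed.

Lemma clip_dist lo hi t q : lo <= t <= hi -> `|clip lo hi q - t| <= `|q - t|.
Proof.
move=> /andP[lt th]; have h1 := ler_norm (q - t).
have h2 := ler_norm (- (q - t)); rewrite normrN in h2.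
rewrite ler_norml /clip; case: (leP lo q) => ?.
  by case: (leP hi q) => ?; lra.
by case: (leP hi lo) => ?; lra.
Qed.

Lemma rat_close t (del : R) : 0 < del -> exists q : rat, `|ratr q - t| < del.
Proof.
move=> d0; have /rat_in_itvoo[q] : t - del < t + del by lra.
by rewrite in_itv /= => /andP[h1 h2]; exists q; rewrite ltr_norml; lra.
Qed.

Lemma rat_clip_close lo hi t (del : R) : lo <= t <= hi -> 0 < del ->
  exists q : rat, `|clip lo hi (ratr q) - t| < del.
Proof.
move=> t_in /(rat_close t)[q qd]; exists q.
exact: le_lt_trans (clip_dist _ t_in) qd.
Qed.

End RationalTimes.

Section Flow.
Context {R : realType} {Om : Type}.
Implicit Types (e : R -> R * R -> Om -> \bar R) (phi : R -> R -> R * R -> Om -> R * R).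

Lemma sup_first_coordP e phi (I : set (R * R)) (T : R) w :
  sup_first_coord e phi I T w = +oo%E <->
  forall k : nat, exists z t, [/\ I z, 0 <= t <= T, (t%:E < e 0%R z w)%E &
    k%:R < (phi 0 t z w).1].
Proof.
rewrite /sup_first_coord; split=> [supoo k|unb].
  apply: contrapT => nex.
  suff : (+oo <= k%:R%:E :> \bar R)%E by rewrite leNgt ltry.
  rewrite -supoo; apply: ge_ereal_sup => _ [z Iz <-].
  apply: ge_ereal_sup => _ [t [tT te] <-].
  rewrite lee_fin leNgt; apply/negP => kphi.
  by apply: nex; exists z, t.
apply/eqyP => A A0.
have [z [t [Iz tT te At]]] := unb (Num.truncn A).+1.
rewrite (@le_trans _ _ (phi 0 t z w).1%:E) //.
  by rewrite lee_fin ltW // (lt_trans _ At) // truncnS_gt.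
apply: (@le_trans _ _ (ereal_sup [set (phi 0 t z w).1%:E
  | t in [set t : R | 0 <= t <= T /\ (t%:E < e 0%R z w)%E]])).
  by apply: ereal_sup_ubound; exists t.
by apply: ereal_sup_ubound; exists z.
Qed.

(** Both the lifetime and the flow are controlled near a point of the domain,
    so a point of the segment and a time can be replaced by rational ones. *)
Lemma flow_rat_approx e phi (T A : R) (x0 a y t : R) w :
  lower_semicontinuous
    (fun p : subspace [set p : R * (R * R) | 0 <= p.1] => e p.1 p.2 w) ->
  {within [set p : R * R * (R * R) | 0 <= p.1.1 <= p.1.2 /\
             flow_domain e p.1.1 p.1.2 w p.2],
    continuous (fun p : R * R * (R * R) => phi p.1.1 p.1.2 p.2 w)} ->
  0 <= t <= T -> - a <= y <= a -> (t%:E < e 0%R (x0, y) w)%E ->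
  A < (phi 0 t (x0, y) w).1 ->
  exists q r : rat, let z := (x0, clip (- a) a (ratr r)) in
    let s := clip 0 T (ratr q) in
    (s%:E < e 0%R z w)%E /\ A < (phi 0 s z w).1.
Proof.
move=> lsc cphi tT ya te Aphi.
have [t' tt' t'e] : exists2 t' : R, t < t' & (t'%:E < e 0%R (x0, y) w)%E.
  case: (e 0 (x0, y) w) te => [s| |] // ts; last by exists (t + 1); rewrite ?ltrDl ?ltry.
  by move: ts; rewrite lte_fin => ts; exists ((t + s) / 2); rewrite ?lte_fin; lra.
have [t0 tT'] := andP tT.
have [V nV Ve] := lsc (0, (x0, y)) t' t'e.
have /nbhs_ballP[d1 /= d10 dV] : nbhs (0 : R, (x0, y)) [set p | 0 <= p.1 -> V p].
  have D0 : [set p : R * (R * R) | 0 <= p.1] (0, (x0, y)) by rewrite /= lexx.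
  by have := nV; rewrite /nbhs /= -(nbhs_subspace_in D0).
have D0 : [set p : R * R * (R * R) | 0 <= p.1.1 <= p.1.2 /\
             flow_domain e p.1.1 p.1.2 w p.2] (0, t, (x0, y)).
  by split=> //=; rewrite lexx.
have /subspace_continuousP/(_ _ D0) := cphi.
move=> /cvgrPdist_lt/(_ ((phi 0 t (x0, y) w).1 - A)).
rewrite subr_gt0 => /(_ Aphi) /nbhs_ballP[d2 /= d20 dphi].
pose del := Num.min (Num.min d1 d2) (t' - t).
have del0 : 0 < del by rewrite !lt_min d10 d20 subr_gt0.
have [q qd] := rat_clip_close tT del0.
have [r rd] := rat_clip_close ya del0.
exists q, r; rewrite /=; set z := (x0, _); set s := clip 0 T _.
have dd1 : del <= d1 by rewrite !ge_min lexx.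
have dd2 : del <= d2 by rewrite !ge_min lexx orbT.
have dd3 : del <= t' - t by rewrite !ge_min lexx orbT.
have /andP[s0 sT] : 0 <= s <= T by apply: clip_itv; lra.
have st' : s < t'.
  by have := lt_le_trans qd dd3; rewrite -/s => /ltr_normlW; lra.
have ez : (t'%:E < e 0%R z w)%E.
  apply: (Ve (0, z)); apply: dV => //=; split => /=; first exact: ballxx.
  split => /=; first exact: ballxx.
  by rewrite /ball /= distrC (lt_le_trans rd).
have sz : (s%:E < e 0%R z w)%E by apply: lt_trans ez; rewrite lte_fin.
split=> //.
have := dphi (0, s, z); rewrite /ball /=.
have bz : (`|0 - 0 : R| < d2 /\ `|t - s| < d2) /\ (`|x0 - x0| < d2 /\
    `|y - clip (- a) a (ratr r)| < d2).
  split; split; rewrite ?subrr ?normr0 //.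
    by rewrite distrC (lt_le_trans qd).
  by rewrite distrC (lt_le_trans rd).
have dz : (0 <= 0 :> R) && (0 <= s) /\ flow_domain e 0 s w z.
  by split; rewrite ?lexx.
move=> /(_ bz dz).
rewrite prod_normE gt_max => /andP[/ltr_normlW h _].
by move: h => /=; lra.
Qed.

End Flow.

(** * Almost sure arguments and bounded noise *)

Section AlmostSure.
Context {R : realType} {d : measure_display} {Om : measurableType d}.
Variable P : probability Om R.

(** Two sets that agree almost surely differ by negligible sets, and these are
    measurable. *)
Lemma complete_ae_measurable (A B : set Om) :
  (forall N, P.-negligible N -> measurable N) -> measurable A ->
  {ae P, forall w, A w <-> B w} -> measurable B.
Proof.
move=> cP mA [N [mN N0 NAB]].
have nN C : C `<=` N -> measurable C.
  by move=> CN; apply: cP; exists N; split.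
have -> : B = (A `\` N) `|` (B `&` N).
  have AB w : ~ N w -> (A w <-> B w).
    by move=> Nw; apply: contrapT => h; apply: Nw; apply: NAB.
  apply/seteqP; split=> w /=.
    by move=> Bw; have [Nw|Nw] := pselect (N w); [right|left; split=> //; exact/AB].
  by move=> [[Aw Nw]|[]//]; exact/AB.
apply: measurableU; first exact: measurableD.
by apply: nN; exact: subIsetr.
Qed.

Lemma le_probability_ae (A B : set Om) : measurable A -> measurable B ->
  {ae P, forall w, A w -> B w} -> (P A <= P B)%E.
Proof.
move=> mA mB [N [mN N0 NAB]].
have AB : A `<=` B `|` N.
  move=> w Aw; have [Nw|Nw] := pselect (N w); first by right.
  by left; apply: contrapT => Bw; apply: Nw; apply: NAB => /= /(_ Aw).
rewrite (@le_trans _ _ (P (B `|` N))) //.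
  by apply: le_measure; rewrite ?inE //; exact: measurableU.
rewrite (@le_trans _ _ (P B + P N)%E) //; last by rewrite N0 adde0.
exact: measureU2.
Qed.

End AlmostSure.

Section NoiseEvents.
Context {R : realType} {d : measure_display} {Om : measurableType d}.
Variables (P : probability Om R) (Fil : R -> set_system Om) (W1 W2 : R -> Om -> R).
Hypothesis hFil : filtration_usual P Fil.
Hypothesis hW1 : brownian_motion P Fil W1.
Hypothesis hW2 : brownian_motion P Fil W2.

Definition bounded_noise (k : nat) : set Om := [set w | forall q : rat,
  `|W1 (clip 0 1 (ratr q)) w| <= k%:R /\ `|W2 (clip 0 1 (ratr q)) w| <= k%:R].

Lemma measurable_bounded_noise k : measurable (bounded_noise k).
Proof.
have mW W t : brownian_motion P Fil W -> 0 <= t ->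
    measurable [set w | k%:R < `|W t w|].
  move=> hW t0; apply: (filtration_sub hFil t0).
  have := bm_adapted hW t0 (U := [set x : R | k%:R < `|x|]).
  rewrite setTI; apply.
  apply: (@open_comp _ _ (fun x : R => `|x|) [set x : R | k%:R < x]).
    by move=> x _; exact: norm_continuous.
  exact: open_gt.
have c0 (q : rat) : 0 <= clip 0 1 (ratr q) :> R.
  by have /andP[] := clip_itv (ratr q : R) (@ler01 R).
have -> : bounded_noise k = ~` \bigcup_(q : rat)
    ([set w | k%:R < `|W1 (clip 0 1 (ratr q)) w|] `|`
     [set w | k%:R < `|W2 (clip 0 1 (ratr q)) w|]).
  apply/seteqP; split=> w /=.
    by move=> h [q _ [|]] /=; have [h1 h2] := h q; rewrite ltNge ?h1 ?h2.
  move=> h q; split; rewrite leNgt; apply/negP => hq; apply: h; exists q => //.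
    by left.
  by right.
apply: measurableC; apply: bigcupT_measurable_rat => q.
by apply: measurableU; exact: mW.
Qed.

Lemma bounded_noise_nondecreasing : nondecreasing_seq bounded_noise.
Proof.
move=> j k jk; apply/subsetPset => w h q; have [h1 h2] := h q.
by rewrite (le_trans h1) ?(le_trans h2) ?ler_nat.
Qed.

Lemma continuous_rat_bound (f : R -> R) (C : R) :
  {within [set t : R | 0 <= t], continuous f} ->
  (forall q : rat, `|f (clip 0 1 (ratr q))| <= C) ->
  forall t, 0 <= t <= 1 -> `|f t| <= C.
Proof.
move=> cf hq t t01; rewrite leNgt; apply/negP => Cf.
have t0 : [set t : R | 0 <= t] t by have /andP[] := t01.
have e0 : 0 < `|f t| - C by rewrite subr_gt0.
have [del d0 H] := within_continuous_eps cf t0 e0.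
have [q qd] := rat_clip_close t01 d0.
have q0 : [set t : R | 0 <= t] (clip 0 1 (ratr q)).
  by have /andP[] := clip_itv (ratr q : R) (@ler01 R).
have := H _ q0 qd; have := hq q.
have := lerB_dist (f t) (f (clip 0 1 (ratr q))).
by rewrite [`|f t - _|]distrC; lra.
Qed.

(** A path which is continuous on [[0, 1]] is bounded there, so almost every
    point lies in one of these increasing events. *)
Lemma bounded_noise_cvg : P (bounded_noise k) @[k --> \oo] --> 1%E.
Proof.
have mU : measurable (\bigcup_k bounded_noise k).
  by apply: bigcup_measurable => k _; exact: measurable_bounded_noise.
have <- : P (\bigcup_k bounded_noise k) = 1%E.
  apply/eqP; rewrite eq_le probability_le1 //=.
  rewrite -(probability_setT P); apply: le_probability_ae => //.
  apply: filterS2 (bm_continuous hW1) (bm_continuous hW2) => w c1 c2 _.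
  have bnd (f : R -> R) : {within [set t : R | 0 <= t], continuous f} ->
      exists C, forall t, 0 <= t <= 1 -> `|f t| <= C.
    move=> cf.
    have cf1 : {within `[0, 1], continuous f}.
      by apply: continuous_subspaceW cf => t; rewrite /= in_itv /= => /andP[].
    have /compact_bounded[M [_ hM]] :=
      continuous_compact cf1 (@segment_compact _ 0 1).
    exists (M + 1) => t t01; apply: (hM (M + 1)); first by rewrite ltrDl.
    by exists t; rewrite //= in_itv.
  have [C1 h1] := bnd _ c1; have [C2 h2] := bnd _ c2.
  exists (Num.truncn (Num.max C1 C2)).+1 => // q.
  have c01 := clip_itv (ratr q : R) (@ler01 R).
  have := truncnS_gt (Num.max C1 C2); rewrite gt_max => /andP[k1 k2].
  by rewrite (le_trans (h1 _ c01) (ltW k1)) (le_trans (h2 _ c01) (ltW k2)).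
apply: nondecreasing_cvg_mu => //.
- exact: measurable_bounded_noise.
- exact: bounded_noise_nondecreasing.
Qed.

Lemma noise_bound_of_event (sigma : R) k w : 0 <= sigma ->
  {within [set t : R | 0 <= t], continuous (fun t => W1 t w)} ->
  {within [set t : R | 0 <= t], continuous (fun t => W2 t w)} ->
  bounded_noise k w ->
  noise_bound (2 * sigma * k%:R) (fun t => sigma * (W1 t w - W1 0 w))
    (fun t => sigma * (W2 t w - W2 0 w)).
Proof.
move=> s0 c1 c2 hk.
have bnd (f : R -> R) : {within [set t : R | 0 <= t], continuous f} ->
    (forall q : rat, `|f (clip 0 1 (ratr q))| <= k%:R) ->
    forall t, 0 <= t <= 1 -> `|sigma * (f t - f 0)| <= 2 * sigma * k%:R.
  move=> cf hq t t01; rewrite normrM (ger0_norm s0).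
  have -> : 2 * sigma * k%:R = sigma * (k%:R + k%:R) by ring.
  rewrite ler_wpM2l //.
  have h := continuous_rat_bound cf hq.
  have := ler_normB (f t) (f 0); have := h t t01; have := h 0; rewrite lexx ler01.
  by move=> /(_ isT); lra.
move=> r r01; split.
- by apply: (bnd (fun t => W1 t w)) => // q; have [] := hk q.
- by apply: (bnd (fun t => W2 t w)) => // q; have [] := hk q.
Qed.

End NoiseEvents.

(** * Blow-up over the segment *)

(** By [flow_rat_approx] the event agrees almost surely with a countable
    combination of events each of which involves a single time and a single
    starting point. *)
Lemma measurable_sup_infinite (R : realType) (d : measure_display)
    (Om : measurableType d) (P : probability Om R)
    (e : R -> R * R -> Om -> \bar R) (phi : R -> R -> R * R -> Om -> R * R)
    (T x0 a : R) :
  (forall N, P.-negligible N -> measurable N) ->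
  local_stochastic_flow P e phi -> 0 <= T -> 0 <= a ->
  measurable [set w | sup_first_coord e phi ([set x0] `*` `[- a, a]) T w = +oo%E].
Proof.
move=> cP hphi T0 a0.
pose z (r : rat) : R * R := (x0, clip (- a) a (ratr r)).
pose s (q : rat) : R := clip 0 T (ratr q).
have sT q : 0 <= s q <= T by exact: clip_itv.
have za r : - a <= (z r).2 <= a by apply: clip_itv; lra.
pose A := \bigcap_k \bigcup_q \bigcup_r ([set w | (s q)%:E < e 0%R (z r) w]%E `&`
  phi 0 (s q) (z r) @^-1` [set p : R * R | k%:R < p.1]).
apply: (@complete_ae_measurable _ _ _ P A _ cP).
  apply: bigcap_measurable => [|k _]; first by exists 0%N.
  apply: bigcupT_measurable_rat => q; apply: bigcupT_measurable_rat => r.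
  have /andP[sq0 _] := sT q.
  apply: (flow_measurable hphi) => //.
  apply: (@open_comp _ _ (fst : R * R -> R) [set x : R | k%:R < x]).
    by move=> p _; exact: cvg_fst.
  exact: open_gt.
apply: filterS2 (flow_lsc hphi) (flow_continuous hphi) => w lsc cphi.
split=> [Aw|/sup_first_coordP unb k _].
  apply/sup_first_coordP => k.
  have [q _ [r _ [/= se kphi]]] := Aw k I.
  exists (z r), (s q); split => //; split => //=.
  by rewrite in_itv /= za.
have [[x y] [t [[/= -> ya] tT te kphi]]] := unb k.
rewrite /= in_itv /= in ya.
have [q [r [sz kz]]] := flow_rat_approx lsc cphi tT ya te kphi.
by exists q => //; exists r.
Qed.

Lemma tan_pi2n_gt0 (R : realType) (n : nat) : (2 <= n)%N ->
  0 < tan (pi / (2 * n%:R)) :> R.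
Proof.
move=> n2; have pi0 := pi_gt0 R.
have n2' : 2 <= n%:R :> R by rewrite ler_nat.
rewrite -tan0 ltr_tan ?in_itv /=.
- by rewrite divr_gt0 // mulr_gt0 //; lra.
- by apply/andP; split; lra.
have h : 0 < pi / (2 * n%:R) :> R by rewrite divr_gt0 // mulr_gt0 //; lra.
apply/andP; split; first by lra.
by rewrite ltr_pM2l // ltf_pV2 ?posrE ?mulr_gt0 //; lra.
Qed.

Theorem theorem3p2 (R : realType) (d : measure_display)
    (Om : measurableType d) (P : probability Om R)
    (Fil : R -> set_system Om) (W1 W2 : R -> Om -> R)
    (n : nat) (sigma : R) (F : R[i] -> R[i])
    (e : R -> R * R -> Om -> \bar R)
    (phi : R -> R -> R * R -> Om -> R * R)
    (hFil : filtration_usual P Fil)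
    (hW1 : brownian_motion P Fil W1)
    (hW2 : brownian_motion P Fil W2)
    (hW : independent_processes P W1 W2)
    (hn : (2 <= n)%N)
    (hsigma : 0 <= sigma)
    (hFlip : locally_lipschitzC F)
    (hFO : bigO_powC F n.-1)
    (hphi : flow_of_sde P Fil W1 W2 (poly_drift n F) sigma e phi) :
  exists T : R, 0 < T /\
    (P [set w | sup_first_coord e phi (initial_segment n x0) T w = +oo%E]
       @[x0 --> (+oo : set_system R)] --> 1%E).
Proof.
have tan0 := tan_pi2n_gt0 R hn.
set ta : R := tan _ in tan0.
have [flow sol] := hphi.
have n0 : (0 < n)%N by exact: ltnW.
have [kap0 /andP[kap0_gt0 kap0_le1] cone] : exists2 kap0 : R, 0 < kap0 <= 1 &
  forall kap, 0 < kap <= kap0 -> forall M, 0 <= M -> exists2 X : R, 0 < X &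
    [/\ pushes_right (fun x y => (poly_drift n F (x, y)).1) kap X M,
        pushes_up (fun x y => (poly_drift n F (x, y)).1)
          (fun x y => (poly_drift n F (x, y)).2) kap X M &
        pushes_up (fun x y => (poly_drift n F (x, - y)).1)
          (fun x y => - (poly_drift n F (x, - y)).2) kap X M].
  by case: n hn hFO {hphi sol ta tan0 n0} => [|[|m]] // _; exact: cone_drift.
pose kap := Num.min ta kap0.
have hkap : 0 < kap <= kap0 by rewrite lt_min tan0 kap0_gt0 ge_min lexx orbT.
have kap1 : 0 < kap <= 1.
  by have /andP[-> h] := hkap; rewrite (le_trans h).
have kapt : kap <= ta by rewrite ge_min lexx.
pose E x0 := [set w | sup_first_coord e phi (initial_segment n x0) 1 w = +oo%E].
exists 1; split=> //.
have cP N : P.-negligible N -> measurable N.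
  by move=> nN; apply: (filtration_sub hFil (lexx 0)); exact: filtration_complete nN.
have mE x0 : 0 <= x0 -> measurable (E x0).
  by move=> x00; apply: (measurable_sup_infinite x0 cP flow ler01); rewrite mulr_ge0 // ltW.
(* the bound [X] depends on the noise level [k], but the time [1] does not *)
have low k : exists X : R, forall x0, X < x0 -> (P (bounded_noise W1 W2 k) <= P (E x0))%E.
  have M0 : 0 <= 2 * sigma * k%:R by rewrite !mulr_ge0.
  have [X X0 [hb hup hdown]] := cone kap hkap _ M0.
  exists (Num.max X 4) => x0; rewrite gt_max => /andP[Xx0 x04].
  have x00 : 0 <= x0 by lra.
  apply: le_probability_ae; [exact: (measurable_bounded_noise hFil hW1 hW2)|exact: mE|].
  pose z m k := (x0, kap * x0 * grid m k) : R * R.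
  have pathae : {ae P, forall w, forall m k, 
    [/\ (0 < e 0%R (z m k) w)%E,
      {within [set t : R | 0 <= t /\ (t%:E < e 0%R (z m k) w)%E],
        continuous (fun t => phi 0 t (z m k) w)},
      (forall t, 0 <= t -> (t%:E < e 0%R (z m k) w)%E ->
        (phi 0 t (z m k) w).1 = (z m k).1 +
          \int[lebesgue_measure]_(r in `[0, t])
            (poly_drift n F (phi 0 r (z m k) w)).1 + sigma * (W1 t w - W1 0 w) /\
        (phi 0 t (z m k) w).2 = (z m k).2 +
          \int[lebesgue_measure]_(r in `[0, t])
            (poly_drift n F (phi 0 r (z m k) w)).2 + sigma * (W2 t w - W2 0 w)) &
      ((e 0%R (z m k) w < +oo)%E ->
        `|phi 0 t (z m k) w| @[t --> (fine (e 0%R (z m k) w))^'-] --> +oo)]}.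
    apply: ae_foralln => m; apply: ae_foralln => j.
    have [[_ _ life cont eqn] _ expl] := sol 0 (z m j) (lexx _).
    by apply: filterS3 life cont (filterI eqn expl) => w h1 h2 [h3 h4]; split.
  apply: filterS3 (bm_continuous hW1) (bm_continuous hW2) pathae => w c1 c2 fam Gw.
  have hnoise := noise_bound_of_event hsigma c1 c2 Gw.
  apply/sup_first_coordP => S.
  have [m [j [t [jm t01 te St]]]] := pathwise_escape
    (phi := fun t z => phi 0 t z w) (e := fun z => e 0%R z w)
    n0 hFlip hb hup hdown hnoise X0 kap1 Xx0 (ltW x04) (fun m j _ => fam m j) S%:R.
  exists (z m j), t; split => //; split => //=.
  rewrite in_itv /= -ler_norml; have g1 := grid_bound (R := R) jm.
  have kx : 0 <= kap * x0 by rewrite mulr_ge0 //; case/andP: kap1 => /ltW.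
  rewrite normrM (ger0_norm kx) (@le_trans _ _ (kap * x0)) ?ler_piMr //.
  by rewrite ler_wpM2r.
have finE x0 : 0 <= x0 -> P (E x0) \is a fin_num.
  by move=> x00; apply: fin_num_measure; exact: mE.
have finG k : P (bounded_noise W1 W2 k) \is a fin_num.
  by apply: fin_num_measure; exact: (measurable_bounded_noise hFil hW1 hW2).
have /fine_cvgP[_ /cvgrPdist_lt cvgG] := bounded_noise_cvg hFil hW1 hW2.
apply/fine_cvgP; split.
  by near=> x0; apply: finE; near: x0; exact: nbhs_pinfty_ge.
apply/cvgrPdist_lt => eps eps0.
have [k _ /(_ k (leqnn k)) Gk] := cvgG eps eps0.
have [X lowX] := low k.
near=> x0.
have x00 : 0 <= x0 by near: x0; exact: nbhs_pinfty_ge.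
have Xx0 : X < x0 by near: x0; exact: nbhs_pinfty_gt (num_real _).
have E1 : fine (P (E x0)) <= 1.
  by rewrite -lee_fin fineK ?finE // probability_le1 //; exact: mE.
have GE : fine (P (bounded_noise W1 W2 k)) <= fine (P (E x0)).
  by apply: fine_le; rewrite ?finE ?lowX.
rewrite /= ger0_norm ?subr_ge0 //.
by move: Gk => /ltr_normlW /=; lra.
Unshelve. all: by end_near. Qed.
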